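(* Let $\mathcal A=\{A_1,\dots,A_m\}$ be an irreducible finite family of real $d\times d$ matrices and let $\Pi\in\mathcal A^{\mathbb N}$ be a candidate product. If Algorithm 1 (described in the context) applied to $\mathcal A$ and $\Pi$ terminates after the $k$th iteration, then it produces an invariant convex body $G_k$ for the family $\mathcal A$. If, moreover, the leading eigenvalue of $\Pi$ is either real or complex with an irrational $\mathrm{mod}\ \pi$ argument, then $G_k$ is the unique invariant body of $\mathcal A$ (up to multiplication by a positive constant).
   Context: Family: $\mathcal A=\{A_1,\dots,A_m\}$, $m\ge 1$, is irreducible if the matrices $A_i$ share no common invariant linear subspace other than $\{0\}$ and $\mathbb R^d$. $\mathcal A^{\mathbb N}$ is the set of all finite products of matrices from $\mathcal A$ (repetitions permitted), $\mathcal A^n$ those of length $n$; $|\Pi|$ is the length of $\Pi$. $\rho(S)$ is the spectral radius of a matrix; $\rho(\mathcal A)=\lim_{n\to\infty}\max_{\Pi\in\mathcal A^n}\|\Pi\|^{1/n}$ is the joint spectral radius; $\nu(\Pi)=\rho(\Pi)^{1/|\Pi|}$. A convex body is a convex compact set with nonempty interior, assumed symmetric about the origin. A convex body $G$ is invariant for $\mathcal A$ if $\mathrm{co}\bigl(\bigcup_{i}A_iG\bigr)=\rho(\mathcal A)\,G$. A leading eigenvalue is an eigenvalue of largest modulus; a leading eigenvector is a corresponding eigenvector. For $\lambda=|\lambda|e^{i\varphi}$ the argument is irrational $\mathrm{mod}\ \pi$ if $\varphi/\pi\notin\mathbb Q$. $\Gamma$ is the unit circle in $\mathbb R^2$; for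 $x,y\in\mathbb R^d$ and $K\subset\mathbb R^2$, $\Phi_{x,y}(K)=\{s x+t y:(s,t)\in K\}$. Algorithm 1. Input: a candidate product $\Pi=A_{s_n}\cdots A_{s_1}$, primitive (not a power of a shorter product), with $\nu(\Pi)>0$. Put $\tilde A_j=\nu(\Pi)^{-1}A_j$, $\tilde{\mathcal A}=\{\tilde A_1,\dots,\tilde A_m\}$, $\tilde\Pi=\tilde A_{s_n}\cdots\tilde A_{s_1}$. Let $v$ be the leading eigenvector of $\tilde\Pi$. If the leading eigenvalue is real, $V_1=\{v,-v\}$; if it is non-real and $v=x+iy$ with $x,y\in\mathbb R^d$, then $V_1=\Phi_{x,y}(\Gamma)$. Put $V_j=\tilde A_{s_{j-1}}\cdots\tilde A_{s_1}V_1$, $j=2,\dots,n$. The root is $\mathcal R=\{V_1,\dots,V_n\}$. Zero iteration: $\mathcal V_0=\mathcal H_0=\mathcal R$. $k$th iteration, $k\ge1$: start with $\mathcal V_k=\mathcal V_{k-1}$, $\mathcal H_k=\emptyset$. Go through all pairs $(V,\tilde A)\in\mathcal H_{k-1}\times\tilde{\mathcal A}$ (when $k=1$ the $n$ pairs $(V_j,\tilde A_{s_j})$, $j=1,\dots,n$, are excluded). If $\tilde AV$ lies in the interior of the convex hull of the union of all sets currently in $\mathcal V_k$, skip it; otherwise add the set $\tilde AV$ to both $\mathcal V_k$ and $\mathcal H_k$. When all pairs are exhausted, $G_k$ is the convex hull of the union of all sets in $\mathcal V_k$. Termination: the algorithm halts after the $k$th iteration when $\mathcal V_k=\mathcal V_{k-1}$,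 i.e. $\mathcal H_k=\emptyset$, and outputs $G_k$. *)

(* Defs.v *)
From HB Require Import structures.
From mathcomp Require Import all_boot all_order all_algebra.
From mathcomp Require Import all_classical all_reals all_analysis.
From mathcomp Require Import complex.

Set Implicit Arguments.
Unset Strict Implicit.
Unset Printing Implicit Defensive.

Import Order.TTheory GRing.Theory Num.Theory.
Import numFieldNormedType.Exports.
Import Normc.

Local Open Scope classical_set_scope.
Local Open Scope ring_scope.

(* Points of R^d are column vectors. *)

Definition mx_image (R : realType) (d : nat) (M : 'M[R]_d) (X : set 'cV[R]_d) :
    set 'cV[R]_d :=
  [set M *m x | x in X].

Definition dilate (R : realType) (d : nat) (c : R) (X : set 'cV[R]_d) :
    set 'cV[R]_d :=
  [set c *: x | x in X].

Definition convex_hull (R : realType) (d : nat) (X : set 'cV[R]_d) :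
    set 'cV[R]_d :=
  smallest (@convex_set R 'cV[R]_d) X.

Definition convex_body (R : realType) (d : nat) (G : set 'cV[R]_d) : Prop :=
  [/\ convex_set G, compact G, G° !=set0 & (forall x, G x -> G (- x))].

Definition irreducible_family (R : realType) (d m : nat)
    (A : 'I_m -> 'M[R]_d) : Prop :=
  forall U : {vspace 'cV[R]_d},
    (forall i x, x \in U -> A i *m x \in U) -> U = 0%VS \/ U = fullv.

(* A formal product A_{s_n} ... A_{s_1} is represented by the word
   [:: s_1; ...; s_n] of its indices, listed in order of application. *)
Definition word_mx (R : realType) (d m : nat) (A : 'I_m -> 'M[R]_d)
    (s : seq 'I_m) : 'M[R]_d :=
  foldl (fun M i => A i *m M) 1%:M s.

Definition spectral_radius (R : realType) (d : nat) (M : 'M[R]_d) : R :=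
  sup [set normc z | z in [set z | eigenvalue (map_mx (real_complex R) M) z]].

(* The norm of matrices is the entrywise maximum norm of the library; the limit
   does not depend on the choice of the norm. *)
Definition joint_spectral_radius (R : realType) (d m : nat)
    (A : 'I_m -> 'M[R]_d) : R :=
  lim ((fun n : nat =>
    \big[Num.max/0]_(w : n.-tuple 'I_m) `|word_mx A w| `^ n%:R^-1) @ \oo).

(* Denoted nu(Pi) in the theory of the joint spectral radius. *)
Definition averaged_radius (R : realType) (d m : nat) (A : 'I_m -> 'M[R]_d)
    (s : seq 'I_m) : R :=
  spectral_radius (word_mx A s) `^ (size s)%:R^-1.

Definition invariant_body (R : realType) (d m : nat) (A : 'I_m -> 'M[R]_d)
    (G : set 'cV[R]_d) : Prop :=
  convex_body G /\
  convex_hull (\bigcup_(i in [set: 'I_m]) mx_image (A i) G) =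
    dilate (joint_spectral_radius A) G.

Definition complex_vec (R : realType) (d : nat) (x y : 'cV[R]_d) : 'cV[R[i]]_d :=
  \col_j Complex (x j 0) (y j 0).

Definition leading_eigenpair (R : realType) (d : nat) (M : 'M[R]_d) (z : R[i])
    (v : 'cV[R[i]]_d) : Prop :=
  [/\ v != 0, map_mx (real_complex R) M *m v = z *: v
    & normc z = spectral_radius M].

Definition irrational_mod_pi (R : realType) (z : R[i]) : Prop :=
  exists2 phi : R, z = Complex (normc z * cos phi) (normc z * sin phi)
    & @irrational R (phi / pi).

Definition primitive_word (m : nat) (s : seq 'I_m) : Prop :=
  forall (t : seq 'I_m) (q : nat), (size t < size s)%N -> s <> flatten (nseq q t).

Definition candidate (R : realType) (d m : nat) (A : 'I_m -> 'M[R]_d)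
    (s : seq 'I_m) : Prop :=
  [/\ s <> [::], primitive_word s & 0 < averaged_radius A s].

Definition normalized (R : realType) (d m : nat) (A : 'I_m -> 'M[R]_d)
    (s : seq 'I_m) (i : 'I_m) : 'M[R]_d :=
  (averaged_radius A s)^-1 *: A i.

(* x + i y is a leading eigenvector for the leading eigenvalue z; it is taken
   real, i.e. equal to x, when z is real. *)
Definition starting_eigenvector (R : realType) (d : nat) (M : 'M[R]_d)
    (z : R[i]) (x y : 'cV[R]_d) : Prop :=
  leading_eigenpair M z (complex_vec x y) /\ (complex.Im z = 0 -> y = 0).

(* The image Phi_{x,y}(Gamma) of the unit circle. *)
Definition ellipse (R : realType) (d : nat) (x y : 'cV[R]_d) : set 'cV[R]_d :=
  [set st.1 *: x + st.2 *: y | st in [set st : R * R | st.1 ^+ 2 + st.2 ^+ 2 = 1]].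

Definition first_set (R : realType) (d : nat) (z : R[i]) (x y : 'cV[R]_d) :
    set 'cV[R]_d :=
  if complex.Im z == 0 then [set x; - x] else ellipse x y.

(* The sequence V_1, ..., V_n; indices start at 0, so that entry j is V_{j+1}. *)
Definition root (R : realType) (d m : nat) (B : 'I_m -> 'M[R]_d)
    (s : seq 'I_m) (V1 : set 'cV[R]_d) : seq (set 'cV[R]_d) :=
  [seq mx_image (word_mx B (take j s)) V1 | j <- iota 0 (size s)].

Definition hull_of_seq (R : realType) (d : nat) (Vs : seq (set 'cV[R]_d)) :
    set 'cV[R]_d :=
  convex_hull (\big[setU/set0]_(V <- Vs) V).

(* V_k and H_k are sequences of sets: every added set is a new entry, even if it
   coincides with an earlier one as a subset of R^d.  An element of H_{k-1} is
   designated by its position, a pair of H_{k-1} x {B_1, ..., B_m} by (j, i). *)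

Definition process_pair (R : realType) (d m : nat) (B : 'I_m -> 'M[R]_d)
    (H : seq (set 'cV[R]_d))
    (st : seq (set 'cV[R]_d) * seq (set 'cV[R]_d)) (p : nat * 'I_m) :
    seq (set 'cV[R]_d) * seq (set 'cV[R]_d) :=
  let W := mx_image (B p.2) (nth set0 H p.1) in
  if `[< W `<=` (hull_of_seq st.1)° >] then st
  else (rcons st.1 W, rcons st.2 W).

(* At the first iteration the pairs (V_j, B_{s_j}) are excluded. *)
Definition pairs (R : realType) (d m : nat) (s : seq 'I_m) (k : nat)
    (H : seq (set 'cV[R]_d)) : seq (nat * 'I_m) :=
  [seq p <- [seq (j, i) | j <- iota 0 (size H), i <- enum 'I_m]
     | (k == 1%N) ==> (p \notin zip (iota 0 (size s)) s)].

(* VV and HH are V_0, V_1, ... and H_0, H_1, ... for a run of the algorithm on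
   the normalized family B; the order in which the pairs of an iteration are
   processed is arbitrary. *)
Definition algorithm_run (R : realType) (d m : nat) (B : 'I_m -> 'M[R]_d)
    (s : seq 'I_m) (V1 : set 'cV[R]_d) (VV HH : nat -> seq (set 'cV[R]_d)) :
    Prop :=
  [/\ VV 0%N = root B s V1, HH 0%N = root B s V1
    & forall k : nat, exists2 ps : seq (nat * 'I_m),
        perm_eq ps (pairs s k.+1 (HH k))
        & (VV k.+1, HH k.+1) =
            foldl (process_pair B (HH k)) (VV k, [::]) ps].

(* After termination the further iterations of a run are void. *)
Definition halts_after (R : realType) (d : nat)
    (VV : nat -> seq (set 'cV[R]_d)) (k : nat) : Prop :=
  [/\ (0 < k)%N, VV k = VV k.-1
    & forall l : nat, (0 < l < k)%N -> VV l <> VV l.-1].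

Lemma halt_iff_no_new_set (R : realType) (d m : nat) (B : 'I_m -> 'M[R]_d)
    (s : seq 'I_m) (V1 : set 'cV[R]_d) (VV HH : nat -> seq (set 'cV[R]_d))
    (k : nat) :
  algorithm_run B s V1 VV HH -> VV k.+1 = VV k <-> HH k.+1 = [::].
Proof.
case=> _ _ /(_ k) [ps _ E].
have: VV k.+1 = VV k ++ HH k.+1.
  have -> : VV k.+1 = (VV k.+1, HH k.+1).1 by [].
  have -> : HH k.+1 = (VV k.+1, HH k.+1).2 by [].
  rewrite E.
  have: forall a b : seq (set 'cV[R]_d),
    (foldl (process_pair B (HH k)) (VV k ++ a, a) ps).1 =
    VV k ++ (foldl (process_pair B (HH k)) (VV k ++ a, a) ps).2.
    move=> + _; elim: ps {E} => [|p ps IH] a //=.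
    rewrite {2 4}/process_pair; case: ifP => _ /=; first exact: IH.
    by rewrite rcons_cat; exact: IH.
  by move=> /(_ [::] [::]); rewrite cats0.
move=> ->; split=> [/(congr1 size)|->]; last by rewrite cats0.
rewrite size_cat -[RHS]addn0 => /addnI; exact: size0nil.
Qed.

(* Main.v *)
(** Let B be the normalized family and G the convex hull of the final sets.
    On termination every B_i V is again one of these sets or lies in G, and
    every set is some B_i V', so co(U B_i G) = G; irreducibility makes the
    subspace absorbed by G everything, hence G is a body, and the products of B
    are bounded above and away from 0 in each length, so the joint spectral
    radius is the normalizing constant.

    Uniqueness: let N and N' be the gauges of G and of another invariant body
    G'.  N' does not increase under the rotation that the candidate product
    induces on the root ellipse; orbits of an irrational rotation are dense, so
    N' is constant there, say N' = kappa, and G is contained in {N' <= kappa}.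
    If the maximum M of N on {N' <= kappa} exceeded 1, then for every n some
    product W of length n would satisfy N (W g) = N g = M with N' g <= kappa.
    The point u = g / M of G is a convex combination of points of the final
    sets whose images under W avoid the interior of G.  For long W this forces
    W to follow the candidate product cyclically, by primitivity starting from
    a single root set; so u lies in the hull of that set, and in fact on the set
    itself since N u = 1.  Hence N' u = kappa, contradicting
    N' u <= kappa / M. *)

Require Import Defs.
From HB Require Import structures.
From mathcomp Require Import all_boot all_order all_algebra.
From mathcomp Require Import all_classical all_reals all_analysis.
From mathcomp Require Import complex.
From mathcomp Require Import ring lra zify.

Set Implicit Arguments.
Unset Strict Implicit.
Unset Printing Implicit Defensive.

Import Order.TTheory GRing.Theory Num.Theory.
Import numFieldNormedType.Exports.

Local Open Scope classical_set_scope.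
Local Open Scope ring_scope.

(** * Convex hulls and their linear images *)

Section ConvexSets.
Context {R : realType} {d : nat}.
Implicit Types (C X Y : set 'cV[R]_d) (u v : 'cV[R]_d).

Lemma convexP C : @convex_set R 'cV[R]_d C <->
  forall u v (t : R), C u -> C v -> 0 <= t -> t <= 1 -> C (t *: u + (1 - t) *: v).
Proof.
split=> [cC u v t Cu Cv t0 t1|cC u v t].
  by have /set_mem := cC u v (Itv01 t0 t1) (mem_set Cu) (mem_set Cv).
by rewrite !inE => Cu Cv; exact: cC.
Qed.

Lemma convex_hull_convex X : @convex_set R 'cV[R]_d (convex_hull X).
Proof.
apply/convexP => u v t Xu Xv t0 t1 C [cC XC].
by move/convexP: (cC); apply=> //; [exact: Xu | exact: Xv].
Qed.

Lemma sub_convex_hull X : X `<=` convex_hull X.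
Proof. exact: sub_gen_smallest. Qed.

Lemma convex_hull_min X C :
  @convex_set R 'cV[R]_d C -> X `<=` C -> convex_hull X `<=` C.
Proof. exact: smallest_sub. Qed.

Lemma convex_hullS X Y : X `<=` Y -> convex_hull X `<=` convex_hull Y.
Proof.
move=> XY; apply: convex_hull_min; first exact: convex_hull_convex.
by apply: subset_trans XY _; exact: sub_convex_hull.
Qed.

(** Merges weighted points without normalizing the weights; if both weights vanish, any point of [C]
    serves. *)
Lemma convex_comb C u v a b : @convex_set R 'cV[R]_d C -> C u -> C v ->
  0 <= a -> 0 <= b -> exists2 w, C w & a *: u + b *: v = (a + b) *: w.
Proof.
move=> /convexP cC Cu Cv a0 b0; have [ab0|ab0] := eqVneq (a + b) 0.
  exists u => //; rewrite ab0 scale0r.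
  have -> : a = 0 by lra.
  have -> : b = 0 by lra.
  by rewrite !scale0r addr0.
have abp : 0 < a + b by rewrite lt_neqAle eq_sym ab0 addr_ge0.
exists ((a / (a + b)) *: u + (1 - a / (a + b)) *: v).
  apply: cC => //; first by rewrite divr_ge0 // ltW.
  by rewrite ler_pdivrMr // mul1r lerDl.
rewrite scalerDr !scalerA; congr (_ *: _ + _ *: _); field; exact: ab0.
Qed.

Lemma convex_preimage C (M : 'M[R]_d) : @convex_set R 'cV[R]_d C ->
  @convex_set R 'cV[R]_d [set u | C (M *m u)].
Proof.
move=> /convexP cC; apply/convexP => u v t /= Cu Cv t0 t1.
by rewrite mulmxDr -!scalemxAr; exact: cC.
Qed.

Lemma convex_image C (M : 'M[R]_d) : @convex_set R 'cV[R]_d C ->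
  @convex_set R 'cV[R]_d (mx_image M C).
Proof.
move=> /convexP cC; apply/convexP => _ _ t [u Cu <-] [v Cv <-] t0 t1.
by exists (t *: u + (1 - t) *: v); [exact: cC | rewrite mulmxDr -!scalemxAr].
Qed.

(** Minimality of the hull gives both inclusions, since images and preimages of convex sets under
    [M] are convex. *)
Lemma convex_hull_image X (M : 'M[R]_d) :
  convex_hull (mx_image M X) = mx_image M (convex_hull X).
Proof.
apply/seteqP; split.
  apply: convex_hull_min; first exact/convex_image/convex_hull_convex.
  by move=> _ [u Xu <-]; exists u => //; exact: sub_convex_hull.
move=> _ [u Xu <-]; move: u Xu; apply: convex_hull_min.
  exact/convex_preimage/convex_hull_convex.
by move=> u Xu; apply: sub_convex_hull; exists u.
Qed.

Lemma convex_hull_opp X :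
  (forall u, X u -> X (- u)) -> forall u, convex_hull X u -> convex_hull X (- u).
Proof.
move=> XN; apply: convex_hull_min => [|u Xu]; last exact: sub_convex_hull (XN _ Xu).
apply/convexP => u v t /= Xu Xv t0 t1; rewrite opprD -!scalerN.
by move/convexP: (@convex_hull_convex X); apply.
Qed.

Lemma dilateE (c : R) X : dilate c X = mx_image c%:M X.
Proof.
by apply/seteqP; split=> _ [u Xu <-]; exists u => //; rewrite mul_scalar_mx.
Qed.

Lemma dilateP (c : R) X u : c != 0 -> dilate c X u <-> X (c^-1 *: u).
Proof.
move=> c0; split=> [[v Xv <-]|Xu]; first by rewrite scalerA mulVf ?scale1r.
by exists (c^-1 *: u) => //; rewrite scalerA divff ?scale1r.
Qed.

End ConvexSets.

(** * The gauge (Minkowski functional) of a symmetric convex body *)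

Section Gauge.
Context {R : realType} {d : nat}.
Variable G : set 'cV[R]_d.
Hypothesis bodyG : convex_body G.
Implicit Types (u v : 'cV[R]_d) (r t : R).

Lemma body_ball : exists2 e : R, 0 < e & forall u, `|u| <= e -> G u.
Proof.
have [/convexP cG _ [x0] /nbhs_ballP[e /= e0 xG] sG] := bodyG.
(* By symmetry [u] is the midpoint of [x0 + 2 u] and [- x0]; with [|u| <= e / 4] the first of these
   stays in the ball around [x0]. *)
exists (e / 4) => [|u ue]; first by rewrite divr_gt0.
have -> : u = 2^-1 *: (x0 + 2 *: u) + (1 - 2^-1) *: (- x0).
  rewrite scalerDr scalerA mulVf ?pnatr_eq0 // scale1r.
  have -> : 1 - 2^-1 = 2^-1 :> R by field.
  by rewrite scalerN addrAC subrr add0r.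
apply: cG; rewrite ?invr_ge0 ?invf_le1 ?ler1n //.
  apply: xG; rewrite -ball_normE /ball_ /= opprD addrA subrr add0r normrN normrZ.
  rewrite ger0_norm //; apply: le_lt_trans (ler_wpM2l _ ue) _ => //; lra.
apply: sG; apply: xG; exact: ballxx.
Qed.

Lemma body_bounded : exists2 D : R, 0 < D & forall u, G u -> `|u| <= D.
Proof.
have [_ /compact_bounded[M [_ MG]] _ _] := bodyG.
exists (`|M| + 1) => [|u Gu]; first by rewrite ltr_wpDl.
by apply: MG => //; rewrite (le_lt_trans (ler_norm M)) // ltrDl.
Qed.

Lemma body0 : G 0.
Proof. by have [e e0 eG] := body_ball; apply: eG; rewrite normr0 ltW. Qed.

Lemma body_scale u t : G u -> 0 <= t -> t <= 1 -> G (t *: u).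
Proof.
move=> Gu t0 t1; have [/convexP cG _ _ _] := bodyG.
by have := cG _ _ t Gu body0 t0 t1; rewrite scaler0 addr0.
Qed.

Definition gauge u := inf [set r | 0 < r /\ G (r^-1 *: u)].

Lemma gauge_nonempty u : [set r | 0 < r /\ G (r^-1 *: u)] !=set0.
Proof.
have [e e0 eG] := body_ball; exists (`|u| / e + 1).
have p0 : 0 < `|u| / e + 1 by rewrite ltr_wpDl // divr_ge0 // ltW.
split=> //; apply: eG; rewrite normrZ normfV ger0_norm ?(ltW p0) //.
rewrite mulrC ler_pdivrMr // mulrDr mulr1 mulrCA divff ?gt_eqF // mulr1.
by rewrite lerDl ltW.
Qed.

Lemma gauge_has_lbound u : has_lbound [set r | 0 < r /\ G (r^-1 *: u)].
Proof. by exists 0 => r [/ltW]. Qed.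

Lemma gauge_ge0 u : 0 <= gauge u.
Proof. by apply: lb_le_inf (gauge_nonempty u) _ => r [/ltW]. Qed.

Lemma gauge_le u r : 0 < r -> G (r^-1 *: u) -> gauge u <= r.
Proof. by move=> r0 Gr; apply: ge_inf (gauge_has_lbound u) _ _; split. Qed.

(** [G] is star-shaped about 0, so membership at some scale [t < r] passes to the scale [r]. *)
Lemma gauge_lt u r : gauge u < r -> G (r^-1 *: u).
Proof.
move=> ur; have [t [t0 Gt] tr] := inf_lt (gauge_nonempty u) ur.
have r0 := lt_trans t0 tr.
have -> : r^-1 *: u = (t / r) *: (t^-1 *: u).
  by rewrite scalerA; congr (_ *: _); field; rewrite !gt_eqF.
apply: body_scale => //; first by rewrite divr_ge0 // ltW.
by rewrite ler_pdivrMr // mul1r ltW.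
Qed.

Lemma gauge_upper : exists2 C : R, 0 < C & forall u, gauge u <= C * `|u|.
Proof.
have [e e0 eG] := body_ball; exists e^-1 => [|u]; first by rewrite invr_gt0.
apply/ler_addgt0Pr => t t0.
have p0 : 0 < e^-1 * `|u| + t.
  by rewrite ltr_wpDl // mulr_ge0 // invr_ge0 ltW.
apply: gauge_le => //; apply: eG; rewrite normrZ normfV ger0_norm ?(ltW p0) //.
rewrite mulrC ler_pdivrMr // mulrDr mulrA divff ?gt_eqF // mul1r lerDl.
by rewrite mulr_ge0 // ltW.
Qed.

Lemma gauge_eq0 u : gauge u = 0 -> u = 0.
Proof.
move=> u0; have [D D0 DG] := body_bounded.
apply/eqP; rewrite -normr_eq0 eq_le normr_ge0 andbT.
apply/ler_addgt0Pr => t t0; rewrite add0r.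
have r0 : 0 < t / D by rewrite divr_gt0.
have /DG : G ((t / D)^-1 *: u) by apply: gauge_lt; rewrite u0.
rewrite normrZ normfV (ger0_norm (ltW r0)) mulrC ler_pdivrMr //.
by rewrite mulrCA divff ?gt_eqF // mulr1.
Qed.

Lemma gauge0 : gauge 0 = 0.
Proof.
have [C C0 /(_ 0)] := gauge_upper; rewrite normr0 mulr0 => g0.
by apply/eqP; rewrite eq_le g0 gauge_ge0.
Qed.

Lemma gaugeZ_le u t : 0 < t -> gauge (t *: u) <= t * gauge u.
Proof.
move=> t0; rewrite -ler_pdivrMl //; apply/ler_addgt0Pr => e e0.
have r0 : 0 < gauge u + e by rewrite ltr_wpDl // gauge_ge0.
rewrite ler_pdivrMl //; apply: gauge_le; first by rewrite mulr_gt0.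
rewrite scalerA invfM mulrAC mulVf ?gt_eqF // mul1r.
by apply: gauge_lt; rewrite ltrDl.
Qed.

Lemma gaugeZ u t : 0 <= t -> gauge (t *: u) = t * gauge u.
Proof.
rewrite le_eqVlt => /predU1P[<-|t0]; first by rewrite scale0r mul0r gauge0.
apply/eqP; rewrite eq_le gaugeZ_le //= -ler_pdivlMl //.
have tV0 : 0 < t^-1 by rewrite invr_gt0.
by have := gaugeZ_le (t *: u) tV0; rewrite scalerA mulVf ?gt_eqF // scale1r.
Qed.

Lemma gaugeN u : gauge (- u) = gauge u.
Proof.
have [_ _ _ sG] := bodyG; rewrite /gauge; congr inf; apply/seteqP.
by split=> r [r0 /sG]; rewrite -scalerN ?opprK.
Qed.

(** For scales [a], [b] slightly above the two gauges, [(u + v) / (a + b)] is a convex combination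
    of [u / a] and [v / b]. *)
Lemma gaugeD u v : gauge (u + v) <= gauge u + gauge v.
Proof.
apply/ler_addgt0Pr => e e0.
have e20 : 0 < e / 2 by rewrite divr_gt0.
have a0 : 0 < gauge u + e / 2 by rewrite ltr_wpDl // gauge_ge0.
have b0 : 0 < gauge v + e / 2 by rewrite ltr_wpDl // gauge_ge0.
have Gu : G ((gauge u + e / 2)^-1 *: u) by apply: gauge_lt; rewrite ltrDl.
have Gv : G ((gauge v + e / 2)^-1 *: v) by apply: gauge_lt; rewrite ltrDl.
have [cG _ _ _] := bodyG.
have [w Gw] := convex_comb cG Gu Gv (ltW a0) (ltW b0).
rewrite !scalerA !divff ?gt_eqF // !scale1r => ->.
have -> : gauge u + gauge v + e = (gauge u + e / 2) + (gauge v + e / 2) by field.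
apply: gauge_le; first by rewrite addr_gt0.
by rewrite scalerA mulVf ?scale1r // gt_eqF // addr_gt0.
Qed.

Lemma gauge_continuous : continuous gauge.
Proof.
have [C C0 gC] := gauge_upper.
have lip u v : gauge u - gauge v <= C * `|u - v|.
  rewrite lerBlDl; apply: le_trans (lerD (lexx _) (gC (u - v))).
  by rewrite -{1}(subrK v u) addrC gaugeD.
move=> u; have FF : Filter (nbhs u) := nbhs_filter u.
apply/cvgrPdist_lt => e e0; near=> v.
apply: (@le_lt_trans _ _ (C * `|u - v|)).
  by rewrite ler_norml lip andbT lerNl opprB distrC lip.
rewrite -ltr_pdivlMl //; near: v; apply: cvgr_dist_lt => //.
by rewrite mulr_gt0 // invr_gt0.
Unshelve. all: by end_near. Qed.

(** A relative step by which [u] can move along its own ray while staying within distance [e]; the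
    [+ 1] covers [u = 0]. *)
Lemma shrink_lt u (e : R) : 0 < e -> e / (`|u| + 1) / 2 * `|u| < e.
Proof.
move=> e0; have u0 : 0 <= `|u| by [].
have p0 : 0 < `|u| + 1 by rewrite ltr_wpDl.
have -> : e / (`|u| + 1) / 2 * `|u| = e * (`|u| / (2 * (`|u| + 1))).
  by field; rewrite gt_eqF.
rewrite gtr_pMr // ltr_pdivrMr; lra.
Qed.

(** Closedness of [G] is essential: every [(1 + t)^-1 *: u] with [t > 0] lies in [G], and these
    points tend to [u]. *)
Lemma gauge_le1 u : gauge u <= 1 <-> G u.
Proof.
split=> [u1|Gu]; last by apply: gauge_le; rewrite ?invr1 ?scale1r.
have [_ /(compact_closed (@norm_hausdorff _ _)) clG _ _] := bodyG.
apply: contrapT => nGu.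
have : nbhs u (~` G) by apply: open_nbhs_nbhs; split=> //; exact: closed_openC.
move=> /nbhs_ballP[e /= e0 uG].
pose t := e / (`|u| + 1) / 2.
have p0 : 0 < `|u| + 1 by rewrite ltr_wpDl.
have t0 : 0 < t by rewrite !divr_gt0.
have t10 : 0 < 1 + t by rewrite addr_gt0.
have /uG : ball u e ((1 + t)^-1 *: u).
  rewrite -ball_normE /ball_ /= -{1}(scale1r u) -scalerBl normrZ.
  have -> : 1 - (1 + t)^-1 = t / (1 + t) by field; rewrite gt_eqF.
  rewrite ger0_norm ?divr_ge0 ?ltW //.
  apply: (@le_lt_trans _ _ (t * `|u|)).
    by rewrite ler_wpM2r // ler_pdivrMr // ler_peMr ?(ltW t0) // lerDl ltW.
  by rewrite /t shrink_lt.
by apply; apply: gauge_lt; rewrite (le_lt_trans u1) // ltrDl.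
Qed.

(** An interior point can be pushed outwards by a factor [1 + t] without leaving [G]. *)
Lemma gauge_interior u : G° u -> gauge u < 1.
Proof.
move=> /nbhs_ballP[e /= e0 uG].
pose t := e / (`|u| + 1) / 2.
have p0 : 0 < `|u| + 1 by rewrite ltr_wpDl.
have t0 : 0 < t by rewrite !divr_gt0.
have t10 : 0 < 1 + t by rewrite addr_gt0.
have : G ((1 + t) *: u).
  apply: uG; rewrite -ball_normE /ball_ /= scalerDl scale1r opprD addrA subrr.
  rewrite add0r normrN normrZ (ger0_norm (ltW t0)) /t.
  exact: shrink_lt.
move/gauge_le1; rewrite gaugeZ ?(ltW t10) // => h.
rewrite -(ltr_pM2l t10) mulr1; lra.
Qed.

Lemma gauge_image (M : 'M[R]_d) u :
  (forall v, G v -> G (M *m v)) -> gauge (M *m u) <= gauge u.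
Proof.
move=> MG; apply/ler_addgt0Pr => e e0.
have r0 : 0 < gauge u + e by rewrite ltr_wpDl // gauge_ge0.
apply: gauge_le => //; rewrite scalemxAr; apply: MG.
by apply: gauge_lt; rewrite ltrDl.
Qed.

Lemma convex_gauge_lt (M : 'M[R]_d) r :
  @convex_set R 'cV[R]_d [set u | gauge (M *m u) < r].
Proof.
apply/convexP => u v t /= ur vr t0 t1.
rewrite mulmxDr -!scalemxAr; apply: le_lt_trans (gaugeD _ _) _.
rewrite !gaugeZ ?subr_ge0 //.
(* The strict inequality is drawn from the term in [u], whose weight must therefore be nonzero. *)
have [->|tn0] := eqVneq t 0; first by rewrite mul0r subr0 mul1r add0r.
have tp : 0 < t by rewrite lt_neqAle eq_sym tn0.
have : t * gauge (M *m u) < t * r by rewrite ltr_pM2l.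
have : (1 - t) * gauge (M *m v) <= (1 - t) * r.
  by rewrite ler_wpM2l ?subr_ge0 // ltW.
lra.
Qed.

Lemma convex_gauge_le r : @convex_set R 'cV[R]_d [set u | gauge u <= r].
Proof.
apply/convexP => u v t /= ur vr t0 t1.
apply: le_trans (gaugeD _ _) _; rewrite !gaugeZ ?subr_ge0 //.
have := ler_wpM2l t0 ur.
have : (1 - t) * gauge v <= (1 - t) * r by rewrite ler_wpM2l ?subr_ge0.
lra.
Qed.

End Gauge.

(** * Compactness of hulls, and the hulls of point pairs and ellipses *)

Section HullCompactness.
Context {R : realType} {d : nat}.
Implicit Types (C X Y : set 'cV[R]_d) (u v x y : 'cV[R]_d) (r s t : R).

Lemma norm_coef m n (M : 'M[R]_(m, n)) i j : `|M i j| <= `|M|.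
Proof.
rewrite [leRHS]/Num.Def.normr /= mx_normrE.
exact: (@le_bigmax _ _ _ 0 (fun ij => `|M ij.1 ij.2|) (i, j)).
Qed.

Lemma norm_mx_le m n (M : 'M[R]_(m, n)) r :
  0 <= r -> (forall i j, `|M i j| <= r) -> `|M| <= r.
Proof.
move=> r0 Mr; rewrite [leLHS]/Num.Def.normr /= mx_normrE.
by apply: bigmax_le => // -[i j] _; exact: Mr.
Qed.

Lemma norm_mulmx (M : 'M[R]_d) u : `|M *m u| <= d%:R * `|M| * `|u|.
Proof.
have c0 : 0 <= d%:R * `|M| * `|u| by rewrite !mulr_ge0.
apply: norm_mx_le => // i j.
rewrite mxE; apply: le_trans (ler_norm_sum _ _ _) _.
rewrite -mulrA -[d in d%:R]card_ord -sum1_card natr_sum mulr_suml.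
apply: ler_sum => l _; rewrite mul1r normrM; apply: ler_pM => //; exact: norm_coef.
Qed.

Lemma mulmx_continuous (M : 'M[R]_d) :
  continuous (fun u : 'cV[R]_d => M *m u).
Proof.
move=> u; have FF : Filter (nbhs u) := nbhs_filter u.
apply/cvgrPdist_lt => e e0; near=> v; rewrite -mulmxBr.
have c0 : 0 < d%:R * `|M| + 1 by rewrite ltr_wpDl // mulr_ge0.
apply: le_lt_trans (norm_mulmx _ _) _.
apply: (@le_lt_trans _ _ ((d%:R * `|M| + 1) * `|u - v|)).
  by rewrite ler_wpM2r // lerDl.
rewrite -ltr_pdivlMl //; near: v; apply: cvgr_dist_lt => //.
by rewrite mulr_gt0 // invr_gt0.
Unshelve. all: by end_near. Qed.

Lemma compact_mx_image (M : 'M[R]_d) X : compact X -> compact (mx_image M X).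
Proof.
move=> cX; apply: continuous_compact => //; apply: continuous_subspaceT.
exact: mulmx_continuous.
Qed.

(** The union of all segments from [C] to [C'], a continuous image of [[0, 1] * C * C']. Adding one
    set at a time in this way gives compact hulls of finite unions. *)
Definition join C C' := [set w : 'cV[R]_d | exists a b : R, exists u v,
  [/\ 0 <= a, 0 <= b, a + b = 1 & C u /\ C' v] /\ w = a *: u + b *: v].

Lemma convex_join C C' : @convex_set R 'cV[R]_d C ->
  @convex_set R 'cV[R]_d C' -> @convex_set R 'cV[R]_d (join C C').
Proof.
move=> cC cC'; apply/convexP => w w' t [a [b [u [v [[a0 b0 ab [Cu Cv]] ->]]]]].
move=> [a' [b' [u' [v' [[a0' b0' ab' [Cu' Cv']] ->]]]]] t0 t1 {w w'}.
have t1' : 0 <= 1 - t by rewrite subr_ge0.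
have [u'' Cu'' eu] := convex_comb cC Cu Cu' (mulr_ge0 t0 a0) (mulr_ge0 t1' a0').
have [v'' Cv'' ev] := convex_comb cC' Cv Cv' (mulr_ge0 t0 b0) (mulr_ge0 t1' b0').
exists (t * a + (1 - t) * a'), (t * b + (1 - t) * b'), u'', v''; split.
  split; rewrite ?addr_ge0 ?mulr_ge0 //.
  have -> : b = 1 - a by lra.
  have -> : b' = 1 - a' by lra.
  ring.
by rewrite -eu -ev !scalerDr !scalerA addrACA.
Qed.

(** The join with an empty set is empty, whence the two hypotheses. *)
Lemma convex_hull_join X Y : X !=set0 -> Y !=set0 ->
  convex_hull (X `|` Y) = join (convex_hull X) (convex_hull Y).
Proof.
move=> [x0 Xx0] [y0 Yy0]; apply/seteqP; split.
  apply: convex_hull_min; first by apply: convex_join; exact: convex_hull_convex.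
  move=> u [Xu|Yu].
    exists 1, 0, u, y0; rewrite scale1r scale0r !addr0.
    by split=> //; split=> //; split; exact: sub_convex_hull.
  exists 0, 1, x0, u; rewrite scale1r scale0r !add0r.
  by split=> //; split=> //; split; exact: sub_convex_hull.
move=> _ [a [b [u [v [[a0 b0 ab [Xu Yv]] ->]]]]].
have -> : b = 1 - a by lra.
move/convexP: (@convex_hull_convex R d (X `|` Y)); apply=> //; last by lra.
  by apply: convex_hullS Xu => w; left.
by apply: convex_hullS Yv => w; right.
Qed.

Lemma compact_join C C' : compact C -> compact C' -> compact (join C C').
Proof.
move=> cC cC'.
pose f (p : R * ('cV[R]_d * 'cV[R]_d)) := p.1 *: p.2.1 + (1 - p.1) *: p.2.2.
have -> : join C C' = f @` (`[0, 1]%classic `*` (C `*` C')).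
  apply/seteqP; split.
    move=> _ [a [b [u [v [[a0 b0 ab [Cu Cv]] ->]]]]].
    exists (a, (u, v)) => /=.
      by split=> //=; rewrite in_itv /= a0 /=; lra.
    by rewrite /f /=; congr (_ + _ *: _); lra.
  move=> _ [[a [u v]] [/= a01 [Cu Cv]] <-]; rewrite in_itv /= in a01.
  exists a, (1 - a), u, v; split=> //; split=> //; lra.
apply: continuous_compact; last first.
  by apply: compact_setX; [exact: segment_compact | exact: compact_setX].
apply: continuous_subspaceT => -[a [u v]].
apply: cvgD; apply: cvgZ.
- exact: cvg_fst.
- apply: cvg_comp; [exact: cvg_snd | exact: cvg_fst].
- by apply: cvgB; [exact: cvg_cst | exact: cvg_fst].
- apply: cvg_comp; [exact: cvg_snd | exact: cvg_snd].
Qed.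

Lemma compact_hullU X Y : compact (convex_hull X) ->
  compact (convex_hull Y) -> compact (convex_hull (X `|` Y)).
Proof.
move=> cX cY; have [->|/set0P X0] := eqVneq X set0; first by rewrite set0U.
have [->|/set0P Y0] := eqVneq Y set0; first by rewrite setU0.
by rewrite convex_hull_join //; exact: compact_join.
Qed.

Lemma compact_hull_of_seq (Vs : seq (set 'cV[R]_d)) :
  (forall V, V \in Vs -> compact (convex_hull V)) -> compact (hull_of_seq Vs).
Proof.
rewrite /hull_of_seq; elim: Vs => [|V Vs IH] cV.
  rewrite big_nil (_ : convex_hull set0 = set0); first exact: compact0.
  by apply: smallest_id; apply/convexP.
rewrite big_cons; apply: compact_hullU; first by apply: cV; rewrite mem_head.
by apply: IH => W WVs; apply: cV; rewrite in_cons WVs orbT.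
Qed.

Lemma hull_of_seqP (Vs : seq (set 'cV[R]_d)) V :
  V \in Vs -> V `<=` hull_of_seq Vs.
Proof.
move=> VVs; apply: subset_trans (@sub_convex_hull _ _ _).
elim: Vs VVs => // W Vs IH; rewrite in_cons big_cons => /predU1P[->|/IH VVs] u Vu.
  by left.
by right; apply: VVs.
Qed.

Lemma hull_of_seq_min (Vs : seq (set 'cV[R]_d)) C :
  @convex_set R 'cV[R]_d C -> (forall V, V \in Vs -> V `<=` C) ->
  hull_of_seq Vs `<=` C.
Proof.
move=> cC VC; apply: convex_hull_min => //.
elim: Vs VC => [|V Vs IH] VC; first by rewrite big_nil.
rewrite big_cons => u [Vu|]; first by apply: VC Vu; rewrite mem_head.
by apply: IH => W WVs; apply: VC; rewrite in_cons WVs orbT.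
Qed.

(** The cone over [X] with apex 0. It describes the hull of a root set explicitly: a segment or a
    filled ellipse, with [r = 1] on the root set itself. *)
Definition star X := [set u : 'cV[R]_d |
  exists r v, [/\ 0 <= r, r <= 1, X v & u = r *: v]].

Lemma compact_star X : compact X -> compact (star X).
Proof.
move=> cX; pose f (p : R * 'cV[R]_d) := p.1 *: p.2.
have -> : star X = f @` (`[0, 1]%classic `*` X).
  apply/seteqP; split.
    move=> _ [r [v [r0 r1 Xv ->]]]; exists (r, v) => //=.
    by split=> //=; rewrite in_itv /= r0 r1.
  move=> _ [[r v] [/= r01 Xv] <-]; rewrite in_itv /= in r01.
  by case/andP: r01 => r0 r1; exists r, v.
apply: continuous_compact; last first.
  by apply: compact_setX => //; exact: segment_compact.
apply: continuous_subspaceT => -[a u].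
by apply: cvgZ; [exact: cvg_fst | exact: cvg_snd].
Qed.

(** By symmetry [r *: v] lies on the segment between [v] and [- v], with weight [(1 + r) / 2] on
    [v]. *)
Lemma convex_hull_star X : (forall u, X u -> X (- u)) ->
  @convex_set R 'cV[R]_d (star X) -> convex_hull X = star X.
Proof.
move=> XN cX; apply/seteqP; split.
  by apply: convex_hull_min => // u Xu; exists 1, u; rewrite scale1r.
move=> _ [r [v [r0 r1 Xv ->]]].
have -> : r *: v = ((1 + r) / 2) *: v + (1 - (1 + r) / 2) *: (- v).
  by rewrite scalerN -scalerBl; congr (_ *: _); field.
move/convexP: (@convex_hull_convex R d X); apply; try lra.
  exact: sub_convex_hull.
exact: sub_convex_hull (XN _ Xv).
Qed.

Lemma unit_circle_param s t : s ^+ 2 + t ^+ 2 = 1 ->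
  exists2 a : R, - pi <= a <= pi & s = cos a /\ t = sin a.
Proof.
move=> st1; have s1 : -1 <= s <= 1.
  have := sqr_ge0 t; rewrite -ler_norml -(@expr_le1 _ 2) //.
  by rewrite real_normK ?num_real //; lra.
have ps := acos_ge0 s1; have pl := acos_lepi s1.
have cs : cos (acos s) = s by apply: acosK; rewrite in_itv.
have ss : sin (acos s) = `|t|.
  by rewrite sin_acos // -st1 addrAC subrr add0r sqrtr_sqr.
have [t0|t0] := leP 0 t.
  exists (acos s); first by rewrite pl andbT (le_trans _ ps) // oppr_le0 pi_ge0.
  by rewrite cs ss ger0_norm.
exists (- acos s).
  by rewrite lerN2 pl /= (le_trans _ (pi_ge0 R)) // oppr_le0.
by rewrite cosN sinN cs ss ltr0_norm ?opprK.
Qed.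

Lemma compact_ellipse x y : compact (ellipse x y).
Proof.
pose f (a : R) := cos a *: x + sin a *: y.
have -> : ellipse x y = f @` `[- pi, pi]%classic.
  apply/seteqP; split.
    move=> _ [[s t] /= /unit_circle_param[a aP [-> ->]] <-].
    by exists a => //=; rewrite in_itv.
  by move=> _ [a _ <-]; exists (cos a, sin a) => //=; exact: cos2Dsin2.
apply: continuous_compact (@segment_compact _ _ _).
apply: continuous_subspaceT => a; apply: cvgD; apply: cvgZr_tmp.
  exact: continuous_cos.
exact: continuous_sin.
Qed.

Lemma ellipseN x y u : ellipse x y u -> ellipse x y (- u).
Proof.
move=> [[s t] /= st <-]; exists (- s, - t) => /=; first by rewrite !sqrrN.
by rewrite !scaleNr opprD.
Qed.

Lemma star_ellipseP x y u : star (ellipse x y) u <->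
  exists s t : R, s ^+ 2 + t ^+ 2 <= 1 /\ u = s *: x + t *: y.
Proof.
split=> [[r [_ [r0 r1 [[s t] /= st <-] ->]]]|[s [t [st ->]]]].
  exists (r * s), (r * t); rewrite scalerDr !scalerA; split=> //.
  by rewrite !exprMn -mulrDr st mulr1 expr_le1.
pose r := Num.sqrt (s ^+ 2 + t ^+ 2).
have st0 : 0 <= s ^+ 2 + t ^+ 2 by rewrite addr_ge0 ?sqr_ge0.
have r2 : r ^+ 2 = s ^+ 2 + t ^+ 2 by rewrite sqr_sqrtr.
have r0 : 0 <= r by exact: sqrtr_ge0.
have r1 : r <= 1 by rewrite -(@expr_le1 _ 2) // r2.
(* The centre has no direction to normalize; the point [x] of the ellipse, scaled by 0, represents
   it. *)
have [re0|rn0] := eqVneq r 0.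
  exists 0, x; split=> //.
    by exists (1, 0) => /=; rewrite ?expr1n ?expr0n ?addr0 // scale1r scale0r addr0.
  rewrite re0 expr0n /= in r2.
  have -> : s = 0 by nra.
  have -> : t = 0 by nra.
  by rewrite !scale0r addr0.
exists r, ((s / r) *: x + (t / r) *: y); split=> //.
  exists (s / r, t / r) => //=.
  by rewrite !expr_div_n -mulrDl -r2 divff // expf_neq0.
by rewrite scalerDr !scalerA !mulrA ![r * _]mulrC !mulfK.
Qed.

Lemma convex_star_ellipse x y : @convex_set R 'cV[R]_d (star (ellipse x y)).
Proof.
apply/convexP => u v r /star_ellipseP[s [t [st ->]]] /star_ellipseP[s' [t' [st' ->]]].
move=> r0 r1; apply/star_ellipseP.
exists (r * s + (1 - r) * s'), (r * t + (1 - r) * t'); split; last first.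
  by rewrite !scalerDr !scalerA !scalerDl addrACA.
(* Cauchy-Schwarz for two points of the unit disc; it bounds the cross term of the square below. *)
have h : s * s' + t * t' <= 1.
  have := sqr_ge0 (s - s'); have := sqr_ge0 (t - t'); nra.
have -> : (r * s + (1 - r) * s') ^+ 2 + (r * t + (1 - r) * t') ^+ 2 =
  r ^+ 2 * (s ^+ 2 + t ^+ 2) + (1 - r) ^+ 2 * (s' ^+ 2 + t' ^+ 2)
  + 2 * (r * (1 - r)) * (s * s' + t * t') by ring.
have := ler_wpM2l (sqr_ge0 r) st; have := ler_wpM2l (sqr_ge0 (1 - r)) st'.
have r1' : 0 <= r * (1 - r) by rewrite mulr_ge0 // subr_ge0.
have := ler_wpM2l r1' h; nra.
Qed.

Lemma convex_star_pair x : @convex_set R 'cV[R]_d (star [set x; - x]).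
Proof.
have P u : star [set x; - x] u <-> exists s : R, `|s| <= 1 /\ u = s *: x.
  split=> [[r [_ [r0 r1 [->|->] ->]]]|[s [s1 ->]]].
  - by exists r; rewrite ger0_norm.
  - by exists (- r); rewrite normrN ger0_norm // scaleNr scalerN.
  have [s0|s0] := leP 0 s.
    by exists s, x; split=> //; [rewrite -(ger0_norm s0) | left].
  exists (- s), (- x); rewrite scalerN scaleNr opprK oppr_ge0 ltW //.
  by split=> //; [rewrite -(ltr0_norm s0) | right].
apply/convexP => u v r /P[s [s1 ->]] /P[t [t1 ->]] r0 r1; apply/P.
exists (r * s + (1 - r) * t); rewrite !scalerA -scalerDl; split=> //.
move: s1 t1; rewrite !ler_norml => /andP[] ? ? /andP[] ? ?; apply/andP; split; nra.
Qed.

Lemma first_setN (z : R[i]) x y u : first_set z x y u -> first_set z x y (- u).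
Proof.
rewrite /first_set; case: ifP => _; last exact: ellipseN.
by move=> [->|->]; [right | left; rewrite opprK].
Qed.

Lemma hull_first_set (z : R[i]) x y :
  convex_hull (first_set z x y) = star (first_set z x y).
Proof.
apply: convex_hull_star; first exact: first_setN.
by rewrite /first_set; case: ifP => _;
  [exact: convex_star_pair | exact: convex_star_ellipse].
Qed.

Lemma compact_hull_first_set (z : R[i]) x y :
  compact (convex_hull (first_set z x y)).
Proof.
rewrite hull_first_set; apply: compact_star; rewrite /first_set.
by case: ifP => _; [apply: compactU; exact: compact_set1 | exact: compact_ellipse].
Qed.

End HullCompactness.

(** * Products of matrices along words *)

Section Words.
Context {R : realType} {d m : nat}.
Implicit Types (B : 'I_m -> 'M[R]_d) (w : seq 'I_m).

Lemma word_mx_cat B w w' : word_mx B (w ++ w') = word_mx B w' *m word_mx B w.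
Proof.
rewrite /word_mx foldl_cat; set M := foldl _ _ w.
elim/last_ind: w' => [|w' i IH] /=; first by rewrite mul1mx.
by rewrite !foldl_rcons IH mulmxA.
Qed.

Lemma word_mx_cons B i w : word_mx B (i :: w) = word_mx B w *m B i.
Proof. by rewrite -cat1s word_mx_cat {2}/word_mx /= mulmx1. Qed.

Lemma word_mx_scale B c w :
  word_mx (fun i => c *: B i) w = c ^+ size w *: word_mx B w.
Proof.
elim: w => [|i w IH]; first by rewrite expr0 scale1r.
by rewrite !word_mx_cons IH -scalemxAl -scalemxAr scalerA exprSr.
Qed.

Lemma word_mx_stable B (G : set 'cV[R]_d) w u :
  (forall i u, G u -> G (B i *m u)) -> G u -> G (word_mx B w *m u).
Proof.
move=> BG; elim: w u => [|i w IH] u Gu; first by rewrite mul1mx.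
by rewrite word_mx_cons -mulmxA; apply/IH/BG.
Qed.

(** Iterating [hullG]-type inclusions, [G] lies in the hull of its images under the products of
    length [n]. A convex condition on [G] may thus be tested on such images, for any [n]. *)
Lemma hull_words B (G C : set 'cV[R]_d) n :
  G `<=` convex_hull (\bigcup_(i in [set: 'I_m]) mx_image (B i) G) ->
  @convex_set R 'cV[R]_d C ->
  (forall w u, size w = n -> G u -> C (word_mx B w *m u)) -> G `<=` C.
Proof.
move=> GB; elim: n C => [|n IH] C cC BC.
  by move=> u Gu; have := BC [::] u erefl Gu; rewrite mul1mx.
apply: IH => // w u sw Gu; move: u {Gu}(GB _ Gu).
apply: convex_hull_min; first exact: convex_preimage.
move=> _ [i _ [u Gu <-]] /=; rewrite mulmxA -word_mx_cons.
by apply: BC => //=; rewrite sw.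
Qed.

End Words.

(** Among the subspaces contained in [D], one of maximal dimension absorbs every [u] of [D], since
    adding the line through [u] stays inside [D]. *)
Lemma vspace_of_closed (K : fieldType) (V : vectType K) (D : set V) :
  D 0 -> (forall (c : K) (u v : V), D u -> D v -> D (c *: u + v)) ->
  exists U : {vspace V}, forall u, u \in U <-> D u.
Proof.
move=> D0 DD.
pose P n := `[< exists U : {vspace V}, (forall u, u \in U -> D u) /\ \dim U = n >].
have exP : exists n, P n.
  exists 0%N; apply/asboolP; exists 0%VS; split; last exact: dimv0.
  by move=> u; rewrite memv0 => /eqP ->.
have ubP n : P n -> (n <= \dim (fullv : {vspace V}))%N.
  by move=> /asboolP[U [_ <-]]; exact/dimvS/subvf.
case: (ex_maxnP exP ubP) => n /asboolP[U [UD <-]] max.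
exists U => u; split=> [/UD//|Du].
have : P (\dim (U + <[u]>)%VS).
  apply/asboolP; exists (U + <[u]>)%VS; split=> // w /memv_addP[a /UD Da].
  by move=> [b /vlineP[k ->] ->]; rewrite addrC; exact: DD.
move=> /max; rewrite (geq_leqif (dimv_leqif_sup (addvSl _ _))) => /subvP; apply.
by rewrite -{1}[u]add0r memv_add ?mem0v ?memv_line.
Qed.

(** * Nonempty interior from irreducibility *)

Section Interior.
Context {R : realType} {d : nat}.
Implicit Types (C : set 'cV[R]_d) (u v : 'cV[R]_d).

Lemma convex_mean C (I : Type) (r : seq I) (f : I -> 'cV[R]_d) :
  @convex_set R 'cV[R]_d C -> C 0 -> (forall i, C (f i)) ->
  C ((size r)%:R^-1 *: \sum_(i <- r) f i).
Proof.
move=> /convexP cC C0 Cf; elim: r => [|i r IH]; first by rewrite big_nil scaler0.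
rewrite big_cons /=; have := cC _ _ ((size r).+1%:R^-1) (Cf i) IH.
rewrite invr_ge0 invf_le1 ?ler1n // => /(_ (ler0n _ _) isT).
(* For an empty tail the inverse of its size is [0^-1 = 0], so the identity between the weights
   below would fail. *)
case: r {IH} => [|j r].
  by rewrite !big_nil /= invr1 subrr scale0r !addr0.
rewrite scalerA scalerDr; set n := size _.
have n0 : n.+1%:R != 0 :> R by rewrite pnatr_eq0.
have n0' : n%:R != 0 :> R by rewrite pnatr_eq0.
suff -> : (1 - n.+1%:R^-1) / n%:R = n.+1%:R^-1 :> R by [].
by rewrite -natr1 in n0 *; field; rewrite n0 n0'.
Qed.

Lemma interior_of_axes C (e : R) : @convex_set R 'cV[R]_d C -> C 0 ->
  (forall u, C u -> C (- u)) -> 0 < e ->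
  (forall j, C (e *: delta_mx j 0)) -> C° !=set0.
Proof.
move=> cC C0 CN e0 Ce; exists 0.
have [d0|d0] := posnP d.
  have -> : C = setT.
    apply/seteqP; split=> // u _; suff -> : u = 0 by [].
    by apply/matrixP => -[i li]; exfalso; rewrite d0 in li.
  by rewrite interiorT.
have dp : 0 < d%:R :> R by rewrite ltr0n.
apply/nbhs_ballP; exists (e / d%:R) => /=; first by rewrite divr_gt0.
move=> u; rewrite -ball_normE /ball_ /= sub0r normrN => ud.
(* [u] is the mean of [d] axis vectors; the factor [d] offsets the mean, and the radius [e / d]
   keeps each coefficient of [e *: delta_mx j 0] in [[-1, 1]]. *)
pose f j := (d%:R * u j 0 / e) *: (e *: (delta_mx j 0 : 'cV[R]_d)).
have -> : u = (size (index_enum 'I_d))%:R^-1 *: \sum_j f j.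
  have -> : size (index_enum 'I_d) = d.
    by rewrite /index_enum -enumT -cardE card_ord.
  rewrite /f [u in LHS]matrix_sum_delta scaler_sumr; apply: eq_bigr => j _.
  rewrite big_ord1 !scalerA; congr (_ *: _); field.
  by rewrite !gt_eqF.
apply: convex_mean => // j; rewrite /f.
have c1 : `|d%:R * u j 0 / e| <= 1.
  rewrite !normrM normfV (ger0_norm (ltW e0)) ler_pdivrMr // mul1r.
  rewrite ger0_norm // -ler_pdivlMl // mulrC; apply: le_trans (ltW ud).
  exact: norm_coef.
have Cs t v : C v -> 0 <= t -> t <= 1 -> C (t *: v).
  move=> Cv t0 t1; move/convexP: cC => /(_ v 0 t Cv C0 t0 t1).
  by rewrite scaler0 addr0.
move: c1; set t := d%:R * _ / e; have [t0|t0] := leP 0 t.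
  by rewrite ger0_norm // => t1; exact: Cs.
rewrite ltr0_norm // => t1; rewrite -(opprK t) scaleNr; apply: CN.
by apply: Cs => //; rewrite oppr_ge0 ltW.
Qed.

Lemma irreducible_interior (m : nat) (A B : 'I_m -> 'M[R]_d) (c : R) C g :
  irreducible_family A -> (forall i, A i = c *: B i) ->
  @convex_set R 'cV[R]_d C -> (forall u, C u -> C (- u)) ->
  (forall i u, C u -> C (B i *m u)) -> C g -> g != 0 -> C° !=set0.
Proof.
move=> irrA AB cC CN BC Cg g0.
have C0 : C 0.
  have := convexP C; case=> /(_ cC) h _.
  have := h _ _ 2^-1 Cg (CN _ Cg); rewrite invr_ge0 invf_le1 ?ler1n //.
  rewrite scalerN -scalerBl => /(_ (ler0n _ _) isT).
  by rewrite (_ : 2^-1 - (1 - 2^-1) = 0 :> R) ?scale0r //; field.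
(* The vectors absorbed by C form an invariant subspace. *)
pose D := [set u | exists2 t : R, 0 < t & C (t *: u)].
have D0 : D 0 by exists 1; rewrite ?scaler0.
have DZ a u : D u -> D (a *: u).
  move=> [t t0 Ct]; have [a0|a0|->] := ltgtP a 0; last by rewrite scale0r.
    exists (t / - a); first by rewrite divr_gt0 // oppr_gt0.
    rewrite scalerA invrN mulrN mulNr divfK ?lt_eqF // scaleNr; exact: CN.
  exists (t / a); first by rewrite divr_gt0.
  by rewrite scalerA divfK ?gt_eqF.
have DD a u v : D u -> D v -> D (a *: u + v).
  move=> /(DZ a)[t t0 Ct] [s s0 Cs]; have ts0 := addr_gt0 t0 s0.
  (* Half the harmonic mean of [t] and [s]: at this scale the sum is a convex combination of
     [t *: (a *: u)] and [s *: v]. *)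
  exists (t * s / (t + s)); first by rewrite divr_gt0 // mulr_gt0.
  have -> : t * s / (t + s) *: (a *: u + v) =
      (s / (t + s)) *: (t *: (a *: u)) + (1 - s / (t + s)) *: (s *: v).
    rewrite scalerDr !scalerA; congr (_ *: _ + _ *: _); field.
      by rewrite gt_eqF.
    by rewrite gt_eqF.
  move/convexP: cC; apply=> //; first by rewrite divr_ge0 // ltW.
  by rewrite ler_pdivrMr // mul1r lerDr ltW.
have [U UP] := vspace_of_closed D0 DD.
have [i u|U0|UT] := irrA U.
- move=> /UP[t t0 Ct]; apply/UP; rewrite AB -scalemxAl; apply: DZ.
  by exists t => //; rewrite scalemxAr; exact: BC.
- have : g \in U by apply/UP; exists 1; rewrite ?scale1r.
  by rewrite U0 memv0 (negbTE g0).
have De j : exists t : R, 0 < t /\ C (t *: delta_mx j 0).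
  have : (delta_mx j 0 : 'cV[R]_d) \in U by rewrite UT memvf.
  by move=> /UP[t]; exists t.
have [t tP] := choice De.
(* One scale for all axes; shrinking towards 0 remains in [C]. *)
pose e := \big[Num.min/1]_j t j.
have e0 : 0 < e by rewrite /e; apply/bigmin_gtP; split=> // j _; case: (tP j).
apply: (@interior_of_axes _ e) => // j.
have [tj0 Cj] := tP j.
have ej : e <= t j by exact: bigmin_le_cond.
move/convexP: cC => /(_ (t j *: delta_mx j 0) 0 (e / t j) Cj C0).
rewrite scaler0 addr0 scalerA divfK ?gt_eqF //; apply.
  by rewrite divr_ge0 // ltW.
by rewrite ler_pdivrMr // mul1r.
Qed.

End Interior.

(** * The joint spectral radius of a family with an invariant body *)

Section JointSpectralRadius.
Context {R : realType} {d m : nat}.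
Variables (B : 'I_m -> 'M[R]_d) (G : set 'cV[R]_d).
Hypotheses (d_gt0 : (0 < d)%N) (bodyG : convex_body G)
  (stableG : forall i u, G u -> G (B i *m u))
  (hullG : G `<=` convex_hull (\bigcup_(i in [set: 'I_m]) mx_image (B i) G)).

(** Every product maps the vectors [e *: delta_mx j 0] of [G] into [G], which has radius at most
    [D]; this bounds each column by [D / e]. *)
Lemma words_bounded : exists2 C : R, 0 < C & forall w, `|word_mx B w| <= C.
Proof.
have [e e0 eG] := body_ball bodyG; have [D D0 GD] := body_bounded bodyG.
exists (D / e) => [|w]; first by rewrite divr_gt0.
have De0 : 0 <= D / e by rewrite divr_ge0 // ltW.
apply: norm_mx_le => // i j.
have : G (e *: delta_mx j 0).
  apply: eG; rewrite normrZ (ger0_norm (ltW e0)) ler_piMr ?(ltW e0) //.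
  apply: norm_mx_le => // k l; rewrite mxE.
  by case: (_ && _); rewrite ?normr1 ?normr0.
move=> /(word_mx_stable w stableG)/GD; rewrite -scalemxAr normrZ.
rewrite (ger0_norm (ltW e0)) => h.
rewrite ler_pdivlMr // mulrC; apply: le_trans h.
rewrite ler_pM2l //; set M := word_mx B w.
have -> : M i j = (M *m delta_mx j 0) i (0 : 'I_1) by rewrite -colE mxE.
exact: norm_coef.
Qed.

(** If all products of some length [n] were too small, [hull_words] would place [G] in the open ball
    of radius [e], although [G] contains the closed one. *)
Lemma words_not_small : exists2 c : R, 0 < c &
  forall n, exists2 w, size w = n & c <= `|word_mx B w|.
Proof.
have [e e0 eG] := body_ball bodyG; have [D D0 GD] := body_bounded bodyG.
have p0 : 0 < d%:R * D + 1 by rewrite ltr_wpDl // mulr_ge0 // ltW.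
exists (e / (d%:R * D + 1)) => [|n]; first by rewrite divr_gt0.
apply: contrapT => nex.
have small w : size w = n -> `|word_mx B w| < e / (d%:R * D + 1).
  by move=> sw; rewrite ltNge; apply/negP => ge; apply: nex; exists w.
have : G `<=` [set u : 'cV[R]_d | `|u| < e].
  apply: (hull_words hullG (n := n)).
    apply/convexP => u v t /= ue ve t0 t1.
    apply: le_lt_trans (ler_normD _ _) _; rewrite !normrZ !ger0_norm ?subr_ge0 //.
    have [->|tn0] := eqVneq t 0; first by rewrite mul0r subr0 mul1r add0r.
    have tp : 0 < t by rewrite lt_neqAle eq_sym tn0.
    have : t * `|u| < t * e by rewrite ltr_pM2l.
    have : (1 - t) * `|v| <= (1 - t) * e by rewrite ler_wpM2l ?subr_ge0 // ltW.
    lra.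
  move=> w u sw Gu /=; apply: le_lt_trans (norm_mulmx _ _) _.
  have /small := sw; rewrite ltr_pdivlMr //; apply: le_lt_trans.
  rewrite mulrDr mulr1 mulrCA -mulrA [leRHS]addrC.
  apply: (@le_trans _ _ (d%:R * (`|word_mx B w| * D))); last by rewrite lerDr.
  by rewrite !ler_wpM2l //; exact: GD.
(* A vector of norm exactly [e]; the all-ones vector has norm 1 because [d > 0]. *)
move=> /(_ (e *: const_mx 1)) /=.
have n1 : `|const_mx 1 : 'cV[R]_d| = 1.
  apply/eqP; rewrite eq_le; apply/andP; split.
    by apply: norm_mx_le => // i j; rewrite mxE normr1.
  by apply: le_trans (norm_coef _ (Ordinal d_gt0) 0); rewrite mxE normr1.
have ne : `|e *: const_mx 1 : 'cV[R]_d| = e.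
  by rewrite normrZ n1 mulr1 ger0_norm // ltW.
by rewrite ne ltxx => h; suff : false by []; apply/h/eG; rewrite ne.
Qed.

Lemma cvg_root (c : R) : 0 < c -> (fun n : nat => c `^ n%:R^-1) @ \oo --> (1 : R).
Proof.
move=> c0; have -> : (fun n : nat => c `^ n%:R^-1) =
    (fun n : nat => expR (n%:R^-1 * ln c)).
  by apply/funext => n; rewrite /powR gt_eqF.
rewrite -[X in _ --> X](expR0).
apply: (@cvg_comp _ _ _ (fun n : nat => n%:R^-1 * ln c) expR _ (nbhs (0 : R))).
  rewrite -[0](mul0r (ln c)); apply: cvgM; last exact: cvg_cst.
  (* [harmonic] is the sequence [1 / (n + 1)], hence the shift. *)
  rewrite -cvg_shiftS; exact: cvg_harmonic.
exact: continuous_expR.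
Qed.

(** The maximum over length [n] is squeezed between [nu] times the [n]th roots of the constants [c]
    and [C], and these roots tend to 1. *)
Lemma joint_spectral_radius_scaled (nu : R) : 0 < nu ->
  joint_spectral_radius (fun i => nu *: B i) = nu.
Proof.
move=> nu0; have [C C0 BC] := words_bounded; have [c c0 cB] := words_not_small.
apply: cvg_lim; first exact: norm_hausdorff.
have root n (x : R) : (0 < n)%N -> 0 <= x ->
    (nu ^+ n * x) `^ n%:R^-1 = nu * x `^ n%:R^-1.
  move=> n0 x0; rewrite powRM ?exprn_ge0 ?(ltW nu0) // -powR_mulrn ?(ltW nu0) //.
  by rewrite -powRrM divff ?pnatr_eq0 -?lt0n // powRr1 // ltW.
have normE w : `|word_mx (fun i => nu *: B i) w| = nu ^+ size w * `|word_mx B w|.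
  by rewrite word_mx_scale normrZ normrX gtr0_norm.
apply: (squeeze_cvgr (f := fun n : nat => nu * c `^ n%:R^-1)
  (h := fun n : nat => nu * C `^ n%:R^-1)).
(* Length 0 is discarded: there the exponent [n%:R^-1] is 0 and the root does not undo the power. *)
- near=> n; have n0 : (0 < n)%N by near: n; exact: nbhs_infty_gt.
  have nV0 : 0 <= n%:R^-1 :> R by rewrite invr_ge0.
  apply/andP; split.
    have [w sw cw] := cB n; have sw' : size w == n by apply/eqP.
    apply: (@le_trans _ _ (`|word_mx (fun i => nu *: B i) w| `^ n%:R^-1)).
      rewrite normE sw root // ler_pM2l //.
      by apply: ge0_ler_powR => //; rewrite nnegrE // ltW.
    exact: (@le_bigmax _ _ _ 0
      (fun w : n.-tuple 'I_m => `|word_mx (fun i => nu *: B i) w| `^ n%:R^-1)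
      (Tuple sw')).
  apply: bigmax_le => [|w _]; first by rewrite mulr_ge0 ?powR_ge0 // ltW.
  rewrite normE size_tuple root // ler_pM2l //.
  by apply: ge0_ler_powR => //; rewrite nnegrE // ltW.
- by rewrite -[X in _ --> X]mulr1; apply: cvgM; [exact: cvg_cst | exact: cvg_root].
- by rewrite -[X in _ --> X]mulr1; apply: cvgM; [exact: cvg_cst | exact: cvg_root].
Unshelve. all: by end_near. Qed.

End JointSpectralRadius.

(** * Spectral radius under scaling, and the action of the candidate on its root set *)

Section Spectrum.
Context {R : realType} {d : nat}.
Implicit Types (M : 'M[R]_d) (z : R[i]) (x y u : 'cV[R]_d).

Lemma sup_scale (c : R) (E : set R) : 0 < c ->
  sup [set c * t | t in E] = c * sup E.
Proof.
(* Without a supremum, [sup] takes the default value 0 on both sides. *)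
move=> c0; have [hE|nE] := pselect (has_sup E); last first.
  rewrite (sup_out nE) mulr0; apply: sup_out => -[[_ [t Et _]] [b bE]].
  apply: nE; split; [by exists t|exists (c^-1 * b)] => s Es.
  by rewrite ler_pdivlMl //; apply: bE; exists s.
have [[t Et] ubE] := hE; apply/eqP; rewrite eq_le; apply/andP; split.
  apply: ge_sup => [|_ [s Es <-]]; first by exists (c * t), t.
  by rewrite ler_pM2l //; exact: ub_le_sup.
rewrite -ler_pdivlMl //; apply: ge_sup => [|s Es]; first by exists t.
rewrite ler_pdivlMl //; apply: ub_le_sup; last by exists s.
exists (c * sup E) => _ [r Er <-]; rewrite ler_pM2l //.
exact: ub_le_sup.
Qed.

Lemma spectral_radius_ge0 M : 0 <= spectral_radius M.
Proof.
rewrite /spectral_radius; set E := [set _ | _ in _].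
have [[[t [z Ez zt]] ubE]|nE] := pselect (has_sup E); last by rewrite sup_out.
apply: (@le_trans _ _ t).
  by rewrite -zt; case: z {Ez zt} => a b; exact: sqrtr_ge0.
by apply: ub_le_sup => //; exists z.
Qed.

Lemma spectral_radius_scale (c : R) M : 0 < c ->
  spectral_radius (c *: M) = c * spectral_radius M.
Proof.
move=> c0; rewrite -sup_scale // /spectral_radius; congr sup.
have c0' : real_complex R c != 0 by rewrite fmorph_eq0 gt_eqF.
have nc : Normc.normc (real_complex R c) = c.
  by rewrite /= expr0n addr0 sqrtr_sqr gtr0_norm.
have mapE : map_mx (real_complex R) (c *: M) =
    real_complex R c *: map_mx (real_complex R) M.
  by apply/matrixP => i j; rewrite !mxE rmorphM.
apply/seteqP; split.
  move=> _ [z /= /eigenvalueP[v vM v0] <-].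
  exists (Normc.normc ((real_complex R c)^-1 * z)); last first.
    by rewrite -{1}nc -Normc.normcM mulVKf.
  exists ((real_complex R c)^-1 * z) => //; apply/eigenvalueP; exists v => //.
  by rewrite -scalerA -vM mapE -scalemxAr scalerA mulVf // scale1r.
move=> _ [_ [z /= /eigenvalueP[v vM v0] <-] <-].
exists (real_complex R c * z); last by rewrite Normc.normcM nc.
apply/eigenvalueP; exists v => //.
by rewrite mapE -scalemxAr vM scalerA.
Qed.

Lemma averaged_radius_exp (m : nat) (A : 'I_m -> 'M[R]_d) (s : seq 'I_m) :
  s <> [::] -> averaged_radius A s ^+ size s = spectral_radius (word_mx A s).
Proof.
move=> s0; rewrite /averaged_radius -powR_mulrn ?powR_ge0 // -powRrM mulVf.
  by rewrite powRr1 // spectral_radius_ge0.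
by rewrite pnatr_eq0 size_eq0; apply/eqP.
Qed.

Lemma complex_vec_eigen M z x y :
  map_mx (real_complex R) M *m complex_vec x y = z *: complex_vec x y ->
  M *m x = complex.Re z *: x - complex.Im z *: y /\
  M *m y = complex.Im z *: x + complex.Re z *: y.
Proof.
have E u v : complex_vec u v =
    map_mx (real_complex R) u + Complex 0 1 *: map_mx (real_complex R) v.
  apply/matrixP => i j; rewrite !mxE [j]ord1 /=.
  by apply/eqP; rewrite eq_complex /= !mul0r !mul1r !subr0 !addr0 !add0r !eqxx.
have -> : map_mx (real_complex R) M *m complex_vec x y =
    complex_vec (M *m x) (M *m y).
  by rewrite !E mulmxDr -scalemxAr !map_mxM.
move=> H; have entry i : Complex ((M *m x) i 0) ((M *m y) i 0) =
    z * Complex (x i 0) (y i 0).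
  by move/matrixP: H => /(_ i 0); rewrite !mxE.
split; apply/matrixP => i j; rewrite [j]ord1.
  by have := congr1 (@complex.Re R) (entry i); case: z {H entry} => a b /= ->;
    rewrite !mxE.
have := congr1 (@complex.Im R) (entry i); case: z {H entry} => a b /= ->.
by rewrite !mxE addrC.
Qed.

(** As [|z| = 1], [M] acts on the coefficients along [x] and [y] as a rotation, which preserves the
    unit circle; a real [z] is 1 or -1. *)
Lemma first_set_invariant M z x y :
  map_mx (real_complex R) M *m complex_vec x y = z *: complex_vec x y ->
  Normc.normc z = 1 -> (complex.Im z = 0 -> y = 0) ->
  mx_image M (first_set z x y) = first_set z x y.
Proof.
move=> /complex_vec_eigen; case: z => a b /= [Mx My] ab1 y0.
have {}ab1 : a ^+ 2 + b ^+ 2 = 1.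
  have := congr1 (fun t => t ^+ 2) ab1.
  by rewrite sqr_sqrtr ?addr_ge0 ?sqr_ge0 // expr1n.
rewrite /first_set /=; have [b0|b0] := eqVneq b 0.
  move: Mx ab1; rewrite b0 scale0r subr0 expr0n addr0 => Mx /eqP.
  rewrite sqrf_eq1 => /orP[]/eqP a1; rewrite a1 ?scaleNr scale1r in Mx.
    apply/seteqP; split=> [_ [u [->|->] <-]|u [->|->]].
    - by left.
    - by right; rewrite /= mulmxN Mx.
    - by exists x => //; left.
    - by exists (- x); [right | rewrite mulmxN Mx].
  apply/seteqP; split=> [_ [u [->|->] <-]|u [->|->]].
  - by right.
  - by left; rewrite /= mulmxN Mx opprK.
  - by exists (- x); [right | rewrite mulmxN Mx opprK].
  - by exists x => //; left.
apply/seteqP; split.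
  move=> _ [_ [[s t] /= st <-] <-].
  exists (s * a + t * b, t * a - s * b) => /=.
    rewrite (_ : _ + _ = (s ^+ 2 + t ^+ 2) * (a ^+ 2 + b ^+ 2)); last by ring.
    by rewrite st ab1 mulr1.
  rewrite mulmxDr -!scalemxAr Mx My !scalerDl scalerBr scalerDr !scalerA.
  by rewrite !scaleNr; apply/matrixP => i j; rewrite !mxE; ring.
move=> _ [[s t] /= st <-].
(* The inverse rotation of the coefficients. *)
exists ((s * a - t * b) *: x + (t * a + s * b) *: y).
  exists (s * a - t * b, t * a + s * b) => //=.
  rewrite (_ : _ + _ = (s ^+ 2 + t ^+ 2) * (a ^+ 2 + b ^+ 2)); last by ring.
  by rewrite st ab1 mulr1.
rewrite mulmxDr -!scalemxAr Mx My.
transitivity ((s * (a ^+ 2 + b ^+ 2)) *: x + (t * (a ^+ 2 + b ^+ 2)) *: y).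
  by apply/matrixP => i j; rewrite !mxE; ring.
by rewrite ab1 !mulr1.
Qed.

End Spectrum.

(** * Density of the orbits of an irrational rotation *)

Section IrrationalRotation.
Context {R : realType}.
Implicit Types (a r t : R).

(** A weak form of Dirichlet's approximation theorem; irrationality makes the small step nonzero. *)
Lemma dirichlet_irrational a (N : nat) : irrational a -> (0 < N)%N ->
  exists n : nat, exists k : int, 0 < `|n%:R * a - k%:~R| < N%:R^-1.
Proof.
move=> irr N0; have NR0 : 0 < N%:R :> R by rewrite ltr0n.
(* Pigeonhole on the fractional parts of 0, a, ..., N a in N boxes. *)
pose fr (i : nat) : R := i%:R * a - (Num.floor (i%:R * a))%:~R.
have fr01 i : 0 <= fr i /\ fr i < 1.
  have /andP[l u] := floor_itv (i%:R * a : R).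
  by rewrite /fr intrD in u *; split; lra.
have box (i : 'I_N.+1) : (Num.truncn (N%:R * fr i) < N)%N.
  have [f0 f1] := fr01 i.
  by rewrite truncn_lt_nat ?mulr_ge0 // gtr_pMr.
pose f i := Ordinal (box i).
have /injectivePn[i [j ij fij]] : ~~ injectiveb f.
  apply/negP => /injectiveP /leq_card; rewrite !card_ord ltnn.
  by [].
wlog ltij : i j ij fij / (i < j)%N.
  move=> H; have := ij; rewrite -(inj_eq val_inj) neq_ltn => /orP[|] lt.
    exact: (H i j).
  by apply: (H j i) => //; rewrite eq_sym.
exists (j - i)%N, (Num.floor (j%:R * a) - Num.floor (i%:R * a)).
have E : (j - i)%:R * a - (Num.floor (j%:R * a) - Num.floor (i%:R * a))%:~R =
    fr j - fr i.
  by rewrite natrB ?(ltnW ltij) // /fr intrB; ring.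
apply/andP; split.
  rewrite normr_gt0 subr_eq0; apply/negP => /eqP ra; apply: irr.
  apply/rationalP; exists (Num.floor (j%:R * a) - Num.floor (i%:R * a)), (j - i)%N.
  by rewrite -ra mulrC mulKf // pnatr_eq0 -lt0n subn_gt0.
rewrite E -(ltr_pM2l NR0) divff ?gt_eqF // -[X in X * _](ger0_norm (ltW NR0)).
rewrite -normrM mulrBr; have /(congr1 val) /= tij := fij.
have [fi0 _] := fr01 i; have [fj0 _] := fr01 j.
have /andP[li ui] := truncn_itv (mulr_ge0 (ltW NR0) fi0).
have /andP[lj uj] := truncn_itv (mulr_ge0 (ltW NR0) fj0).
rewrite -tij -natr1 in lj uj; rewrite -natr1 in ui.
rewrite ltr_norml; apply/andP; split; lra.
Qed.

(** Some step [p = n a - k] is nonzero and arbitrarily short, and [f] does not increase along it.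
    Multiples of [p], modulo 1, lead from [t] to any neighbourhood of [t'], and continuity
    concludes. *)
Lemma irrational_orbit_le (f : R -> R) a : irrational a -> continuous f ->
  (forall t, f (t + 1) = f t) -> (forall t, f (t + a) <= f t) ->
  forall t t', f t' <= f t.
Proof.
move=> irr cf f1 fa t t'.
have fn t0 (n : nat) : f (t0 + n%:R) = f t0.
  elim: n => [|n IH]; first by rewrite addr0.
  by rewrite -natr1 addrA f1.
have fz t0 (k : int) : f (t0 + k%:~R) = f t0.
  case: k => n; first by rewrite -pmulrn fn.
  by rewrite -[t0 in RHS](subrK (n.+1%:R)) fn NegzE mulrNz -pmulrn.
have fna t0 (n : nat) : f (t0 + n%:R * a) <= f t0.
  elim: n => [|n IH]; first by rewrite mul0r addr0.
  by rewrite -natr1 mulrDl mul1r addrA; apply: le_trans IH.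
apply/ler_addgt0Pr => e e0.
have /cvgrPdist_lt/(_ e e0)/nbhs_ballP[r /= r0 fr] := cf t'.
have [N Nr] : exists N : nat, (0 < N)%N /\ N%:R^-1 < r.
  exists (Num.truncn r^-1).+1; split=> //.
  by rewrite invf_plt ?posrE // truncnS_gt.
case: Nr => N0 Nr; have [n [k /andP[p0 pN]]] := dirichlet_irrational irr N0.
set p := n%:R * a - k%:~R in p0 pN.
have fp t0 (l : nat) : f (t0 + l%:R * p) <= f t0.
  elim: l => [|l IH]; first by rewrite mul0r addr0.
  apply: le_trans IH; rewrite -natr1 mulrDl mul1r addrA /p addrA.
  by rewrite -[X in f X <= _]/(_ - k%:~R) -mulrNz fz fna.
rewrite normr_gt0 in p0.
pose Q := (Num.truncn `|t' - t|).+1.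
have Qt : `|t' - t| < Q%:R by exact: truncnS_gt.
(* An integer shift that gives [D = t' - t + q] the sign of [p], so that the number of steps [D / p]
   is nonnegative. *)
pose q : R := Num.sg p * Q%:R.
have fq t0 : f (t0 + q) = f t0.
  rewrite /q; have [pp|pp|pp] := ltgtP p 0; last by rewrite pp eqxx in p0.
    by rewrite ltr0_sg // mulN1r -[t0 in RHS](subrK Q%:R) fn.
  by rewrite gtr0_sg // mul1r fn.
pose D := t' - t + q.
have D0 : 0 <= D / p.
  have [pp|pp|pp] := ltgtP p 0; last by rewrite pp eqxx in p0.
    rewrite -mulrNN -invrN divr_ge0 ?oppr_ge0 ?(ltW pp) //.
    by rewrite /D /q ltr0_sg //; move: Qt; rewrite ltr_norml => /andP[]; lra.
  rewrite divr_ge0 ?(ltW pp) //.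
  by rewrite /D /q gtr0_sg //; move: Qt; rewrite ltr_norml => /andP[]; lra.
set l := Num.truncn (D / p).
have /andP[ll lu] := truncn_itv D0.
(* Truncating [D / p] to [l] costs at most one step, of length [|p| < r]. *)
have near : ball t' r (t + l%:R * p - q).
  rewrite -ball_normE /ball_ /=.
  have -> : t' - (t + l%:R * p - q) = (D / p - l%:R) * p.
    by rewrite mulrBl divfK // /D; ring.
  rewrite normrM; apply: lt_trans Nr; apply: le_lt_trans pN.
  rewrite ler_piMl // ler_norml; rewrite -natr1 -/l in lu; rewrite -/l in ll.
  by apply/andP; split; lra.
have := fr _ near; rewrite -[f (t + _ - q)]fq subrK => h.
have := fp t l; move: h; rewrite ltr_norml => /andP[]; lra.
Qed.

End IrrationalRotation.

(** * Gauges on a rotated ellipse *)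

Section RotatedEllipse.
Context {R : realType} {d : nat}.

Lemma gauge_ellipse_const (G : set 'cV[R]_d) (M : 'M[R]_d) (phi : R)
    (x y u v : 'cV[R]_d) :
  convex_body G -> (forall w, G w -> G (M *m w)) -> irrational (phi / pi) ->
  M *m x = cos phi *: x - sin phi *: y ->
  M *m y = sin phi *: x + cos phi *: y ->
  ellipse x y u -> ellipse x y v -> gauge G u = gauge G v.
Proof.
move=> bG MG irr Mx My.
(* In this parameter [M] is the shift by [phi / pi], and the shift by 1 is [u -> - u], which
   preserves the gauge. This is why irrationality is required modulo [pi]. *)
pose p (t : R) := cos (pi * t) *: x - sin (pi * t) *: y.
have pi0 : pi != 0 :> R by rewrite gt_eqF // pi_gt0.
have paramE w : ellipse x y w -> exists t, w = p t.
  move=> [[s t] /= /unit_circle_param[a _ [-> ->]] <-].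
  exists (- a / pi); rewrite /p mulrC divfK // cosN sinN scaleNr opprK.
  by [].
have cont : continuous (fun t => gauge G (p t)).
  move=> t; apply: (@continuous_comp _ _ _ p (gauge G)); last first.
    exact: gauge_continuous.
  have cpi : {for t, continuous (fun t : R => pi * t)}.
    by apply: cvgM; [exact: cvg_cst | exact: cvg_id].
  apply: cvgB; apply: cvgZr_tmp.
    apply: (@continuous_comp _ _ _ (fun t : R => pi * t) cos) => //.
    exact: continuous_cos.
  apply: (@continuous_comp _ _ _ (fun t : R => pi * t) sin) => //.
  exact: continuous_sin.
have step t : gauge G (p (t + phi / pi)) <= gauge G (p t).
  suff -> : p (t + phi / pi) = M *m p t by exact: gauge_image.
  rewrite /p mulrDr [pi * (phi / pi)]mulrC divfK // cosD sinD.
  rewrite mulmxBr -!scalemxAr Mx My.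
  by apply/matrixP => i j; rewrite !mxE; ring.
have per t : gauge G (p (t + 1)) = gauge G (p t).
  rewrite -[RHS]gaugeN //; congr gauge.
  by rewrite /p mulrDr mulr1 cosDpi sinDpi !scaleNr opprK opprB addrC.
have le := irrational_orbit_le irr cont per step.
move=> /paramE[t ->] /paramE[t' ->].
by apply/eqP; rewrite eq_le !le.
Qed.

End RotatedEllipse.

(** * Periods and rotations of primitive words *)

Section PrimitiveWords.
Context {m : nat}.
Implicit Types (s : seq 'I_m).

Lemma flatten_period (i0 : 'I_m) g q s : size s = (q * g)%N ->
  (forall t, (t + g < size s)%N -> nth i0 s (t + g) = nth i0 s t) ->
  s = flatten (nseq q (take g s)).
Proof.
elim: q s => [|q IH] s sz per; first exact: size0nil.
have gs : (g <= size s)%N by rewrite sz mulSn leq_addr.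
have sd : size (drop g s) = (q * g)%N by rewrite size_drop sz mulSn addKn.
rewrite /= -{1}(cat_take_drop g s); congr (_ ++ _).
rewrite [LHS]IH //; last first.
  move=> t; rewrite sd !nth_drop => tg; rewrite addnA [(g + t)%N]addnC.
  by apply: per; rewrite sz mulSn -addnA addnC; lia.
(* The induction yields powers of the first block of the tail; if the tail is nonempty, this block
   equals that of [s] by periodicity. *)
case: q {IH} sd sz => // q sd sz; congr (flatten (nseq _ _)).
apply: (@eq_from_nth _ i0).
  by rewrite !size_take sd sz !mulSn; case: ifP; case: ifP; lia.
rewrite size_take sd => t; rewrite !mulSn => tlt.
have tg : (t < g)%N by move: tlt; case: ifP; lia.
rewrite !nth_take // nth_drop addnC; apply: per.
by rewrite sz !mulSn; lia.
Qed.

(** Lets one cycle of letters determine the root set at which it starts. Two equal rotations would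
    give [s] a period properly dividing its length. *)
Lemma primitive_rot_inj (i0 : 'I_m) s (a b : nat) : primitive_word s ->
  (a < size s)%N -> (b < size s)%N ->
  (forall t, (t < size s)%N ->
     nth i0 s ((a + t) %% size s) = nth i0 s ((b + t) %% size s)) -> a = b.
Proof.
move=> prim; wlog ab : a b / (a < b)%N.
  move=> H al bl h; case: (ltngtP a b) => // lt; first exact: H.
  by symmetry; apply: H => // t tl; rewrite h.
move=> al bl h; exfalso; set n := size s in al bl h.
have n0 : (0 < n)%N by exact: leq_ltn_trans al.
(* s has the periods n and b - a, hence their gcd, by Bezout. *)
pose f t := nth i0 s (t %% n).
have fn t j : f (t + j * n)%N = f t by rewrite /f addnC modnMDl.
have fab t : f (a + t)%N = f (b + t)%N.
  have := h (t %% n)%N (ltn_pmod _ n0); by rewrite /f !modnDmr.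
have fr t j : f (t + j * (b - a))%N = f t.
  elim: j => [|j IH]; first by rewrite addn0.
  rewrite -[RHS]IH mulSn; set t' := (t + j * (b - a))%N.
  have -> : (t + (b - a + j * (b - a)))%N = (t' + (b - a))%N by lia.
  rewrite -(fn (t' + (b - a))%N a) -(fn t' a).
  (* Adding [a] full periods leaves room to split off [a] without subtraction. *)
  have -> : (t' + a * n = a + (t' + a * n.-1))%N.
    by rewrite -{1}(prednK n0) mulnS; lia.
  rewrite fab; congr f; rewrite -{1}(prednK n0) mulnS; lia.
have r0 : (0 < b - a)%N by rewrite subn_gt0.
(* Bezout in natural numbers: [u * (b - a) = v * n + g]. *)
have [u v Ebz _] := egcdnP n r0.
set g := gcdn (b - a) n in Ebz.
have fg t : f (t + g)%N = f t.
  by rewrite -(fn (t + g)%N v) -addnA [(g + _)%N]addnC -Ebz fr.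
have gn : (g %| n)%N by exact: dvdn_gcdr.
have gr : (g < n)%N.
  by apply: leq_ltn_trans (dvdn_leq r0 (dvdn_gcdl _ _)) _; lia.
apply: (prim (take g s) (n %/ g)%N).
  by rewrite size_take gr.
apply: (@flatten_period i0 g (n %/ g)%N s); first by rewrite divnK.
move=> t tg; have := fg t; rewrite /f !modn_small //.
by apply: leq_ltn_trans tg; exact: leq_addr.
Qed.

End PrimitiveWords.

(** * How sets are created and absorbed during a run *)

Section Runs.
Context {R : realType} {d m : nat}.
Implicit Types (V W : set 'cV[R]_d) (u v : 'cV[R]_d) (w : seq 'I_m).

Lemma mx_image_comp (M N : 'M[R]_d) V :
  mx_image M (mx_image N V) = mx_image (M *m N) V.
Proof.
apply/seteqP; split=> [_ [_ [u Vu <-] <-]|_ [u Vu <-]].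
  by exists u => //; rewrite mulmxA.
by exists (N *m u); [exists u | rewrite mulmxA].
Qed.

(** The current hull only grows, so a set skipped at some moment still lies in the interior of the
    hull at the end of the iteration, whatever the order of the pairs. *)
Lemma process_pairsP (B : 'I_m -> 'M[R]_d) (H vs h : seq (set 'cV[R]_d)) ps :
  let W := fun p : nat * 'I_m => mx_image (B p.2) (nth set0 H p.1) in
  let r := foldl (process_pair B H) (vs, h) ps in
  exists new, [/\ r.1 = vs ++ new, r.2 = h ++ new,
    forall p, p \in ps -> W p \in new \/ W p `<=` (hull_of_seq r.1)°
    & forall V, V \in new -> exists2 p, p \in ps & V = W p].
Proof.
move=> W; elim: ps vs h => [|p ps IH] vs h /=.
  by exists [::]; rewrite !cats0; split.
rewrite [process_pair B H (vs, h) p]/process_pair /= -/(W p).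
case: ifP => [/asboolP inW|_].
  have [new [e1 e2 b c]] := IH vs h; exists new; split=> //.
    move=> q; rewrite in_cons => /predU1P[->|/b //]; right.
    apply: subset_trans inW _; apply: interiorS.
    apply: hull_of_seq_min => [|V Vvs]; first exact: convex_hull_convex.
    by apply: hull_of_seqP; rewrite e1 mem_cat Vvs.
  by move=> V /c[q qps ->]; exists q => //; rewrite in_cons qps orbT.
have [new [e1 e2 b c]] := IH (rcons vs (W p)) (rcons h (W p)).
exists (W p :: new); rewrite -!cat_rcons; split=> //.
  move=> q; rewrite in_cons => /predU1P[->|/b[bq|]]; last by right.
    by left; rewrite mem_head.
  by left; rewrite in_cons bq orbT.
move=> V; rewrite in_cons => /predU1P[->|/c[q qps ->]].
  by exists p => //; rewrite mem_head.
by exists q => //; rewrite in_cons qps orbT.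
Qed.

Variables (B : 'I_m -> 'M[R]_d) (s : seq 'I_m) (V1 : set 'cV[R]_d).
Variables (VV HH : nat -> seq (set 'cV[R]_d)).
Hypotheses (run : algorithm_run B s V1 VV HH).

Lemma run_cat j : VV j.+1 = VV j ++ HH j.+1.
Proof.
have [_ _ /(_ j)[ps _ E]] := run.
have [new [e1 e2 _ _]] := process_pairsP B (HH j) (VV j) [::] ps.
by move: e1 e2; rewrite -E /= => -> ->.
Qed.

(** The second hypothesis leaves out the excluded pairs of the first iteration; its default letter
    [i] is harmless because [q < size s] is tested as well. *)
Lemma run_step j q i : (q < size (HH j))%N ->
  ~~ [&& j == 0%N, (q < size s)%N & nth i s q == i] ->
  let W := mx_image (B i) (nth set0 (HH j) q) in
  W \in HH j.+1 \/ W `<=` (hull_of_seq (VV j.+1))°.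
Proof.
move=> qH excl; have [_ _ /(_ j)[ps pE E]] := run.
have [new [e1 e2 b _]] := process_pairsP B (HH j) (VV j) [::] ps.
move: e1 e2 b; rewrite -E /= => -> -> b; apply: (b (q, i)).
rewrite (perm_mem pE) mem_filter; apply/andP; split; last first.
  apply/allpairsP; exists (q, i) => /=; split=> //; last by rewrite mem_enum.
  by rewrite mem_iota.
apply/implyP => /eqP[j0]; move: excl; rewrite j0 eqxx /=; apply: contra.
move=> /(nthP (0%N, i))[l]; rewrite size_zip size_iota minnn => ls.
by rewrite nth_zip ?size_iota // nth_iota // add0n => -[<-] sl; rewrite ls sl eqxx.
Qed.

Lemma run_origin j V : V \in HH j.+1 ->
  exists i, exists2 V', V' \in HH j & V = mx_image (B i) V'.
Proof.
have [_ _ /(_ j)[ps pE E]] := run.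
have [new [_ e2 _ c]] := process_pairsP B (HH j) (VV j) [::] ps.
move: e2; rewrite -E /= => -> /c[[q i]].
rewrite (perm_mem pE) mem_filter => /andP[_ /allpairsP[[q' i'] /=]].
rewrite mem_iota => -[qH _ [-> ->]] ->.
by exists i', (nth set0 (HH j) q') => //; rewrite mem_nth.
Qed.

Lemma run_VV j V : V \in VV j <-> exists2 i, (i <= j)%N & V \in HH i.
Proof.
have [V0 H0 _] := run; elim: j => [|j IH].
  rewrite V0 -H0; split=> [V0H|]; first by exists 0%N.
  by move=> [l]; rewrite leqn0 => /eqP ->.
rewrite run_cat mem_cat; split.
  case/orP => [/IH[i ij Vi]|Vj]; last by exists j.+1.
  by exists i => //; exact: leqW.
move=> [l]; rewrite leq_eqVlt => /predU1P[-> ->|ij Vi]; first by rewrite orbT.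
by apply/orP; left; apply/IH; exists l.
Qed.

Lemma run_word j V : V \in HH j -> exists w, V = mx_image (word_mx B w) V1.
Proof.
have [_ H0 _] := run; elim: j V => [|j IH] V.
  by rewrite H0 => /mapP[q _ ->]; exists (take q s).
move=> /run_origin[i [V' /IH[w ->] ->]]; exists (rcons w i).
by rewrite mx_image_comp -cats1 word_mx_cat word_mx_cons mul1mx.
Qed.

Variable i0 : 'I_m.
Hypothesis s_gt0 : (0 < size s)%N.
Hypothesis V1_invariant : mx_image (word_mx B s) V1 = V1.

(* The root set V_{q+1}, with indices modulo the length of the candidate. *)
Definition cyclic_root q := mx_image (word_mx B (take (q %% size s) s)) V1.

(** Following the candidate passes from one root set to the next; at the end of the word the cycle
    closes by [V1_invariant]. *)
Lemma cyclic_rootS q :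
  mx_image (B (nth i0 s (q %% size s))) (cyclic_root q) = cyclic_root q.+1.
Proof.
rewrite /cyclic_root mx_image_comp.
rewrite -[B _ *m _](_ : word_mx B (take (q %% size s).+1 s) = _); last first.
  rewrite (take_nth i0) ?ltn_pmod // -cats1 word_mx_cat.
  by rewrite word_mx_cons mul1mx.
have := ltn_pmod q s_gt0; rewrite leq_eqVlt => /predU1P[e|lt].
  rewrite e take_size V1_invariant.
  have -> : (q.+1 %% size s = 0)%N by rewrite -addn1 -modnDml addn1 e modnn.
  rewrite take0; apply/seteqP; split=> [u Vu|_ [u Vu <-]].
    by exists u => //; rewrite mul1mx.
  by rewrite mul1mx.
have -> // : (q.+1 %% size s = (q %% size s).+1)%N.
by rewrite -addn1 -modnDml addn1 modn_small.
Qed.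

Lemma root_cyclic V : V \in HH 0%N ->
  exists2 q, (q < size s)%N & V = cyclic_root q.
Proof.
have [_ -> _] := run => /mapP[q]; rewrite mem_iota => qs ->.
by exists q => //; rewrite /cyclic_root modn_small.
Qed.

Lemma cyclic_root_mem q : cyclic_root q \in HH 0%N.
Proof.
have [_ -> _] := run; apply/mapP; exists (q %% size s)%N => //.
by rewrite mem_iota ltn_pmod.
Qed.

Lemma root_exit q i : nth i0 s (q %% size s) <> i ->
  mx_image (B i) (cyclic_root q) \in HH 1%N \/
  mx_image (B i) (cyclic_root q) `<=` (hull_of_seq (VV 1%N))°.
Proof.
move=> ni; have qs : (q %% size s < size s)%N by exact: ltn_pmod.
have [_ H0 _] := run.
have sH : size (HH 0%N) = size s by rewrite H0 size_map size_iota.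
have := @run_step 0 (q %% size s) i; rewrite sH => /(_ qs).
rewrite qs /= (set_nth_default i0) // => /(_ (introN eqP ni)).
by rewrite H0 (nth_map 0%N) ?size_iota // nth_iota.
Qed.

Variable k : nat.
Hypothesis HHk : HH k = [::].
Hypothesis k_gt0 : (0 < k)%N.

Let G := hull_of_seq (VV k).

(** Every final set was created before the last iteration, so its images have all been examined,
    except those along the root. *)
Lemma run_VV_lt V : V \in VV k <-> exists2 j, (j < k)%N & V \in HH j.
Proof.
split=> [/run_VV[j]|[j jk Vj]]; last by apply/run_VV; exists j => //; exact: ltnW.
by rewrite leq_eqVlt => /predU1P[->|jk Vj]; [rewrite HHk | exists j].
Qed.

Lemma run_hull_mono j : (j <= k)%N -> (hull_of_seq (VV j))° `<=` G°.
Proof.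
move=> jk; apply: interiorS; apply: hull_of_seq_min => [|V /run_VV[i ij Vi]].
  exact: convex_hull_convex.
by apply: hull_of_seqP; apply/run_VV; exists i => //; exact: leq_trans jk.
Qed.

Lemma run_descend j V i : (0 < j)%N -> (j < k)%N -> V \in HH j ->
  mx_image (B i) V \in HH j.+1 \/ mx_image (B i) V `<=` G°.
Proof.
move=> j0 jk VH; have qH : (index V (HH j) < size (HH j))%N by rewrite index_mem.
have := @run_step j _ i qH; rewrite eqn0Ngt j0 nth_index // => /(_ isT)[|h].
  by left.
by right; apply: subset_trans h _; exact: run_hull_mono.
Qed.

(** Three cases for a final set: a root set followed along the candidate, a root set left by another
    letter, and a set created later. *)
Lemma run_stable i u : G u -> G (B i *m u).
Proof.
move: u; apply: hull_of_seq_min.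
  exact/convex_preimage/convex_hull_convex.
have sub W : W \in VV k \/ W `<=` G° -> W `<=` G.
  by move=> [/hull_of_seqP //|WG]; apply: subset_trans WG (@interior_subset _ _).
suff : forall V, V \in VV k ->
    mx_image (B i) V \in VV k \/ mx_image (B i) V `<=` G°.
  by move=> h V VV' u Vu; apply: (sub _ (h _ VV')); exists u.
move=> V /run_VV_lt[[|j] jk Vj].
  have [q qs ->] := root_cyclic Vj.
  have [<-|/eqP ni] := eqVneq (nth i0 s (q %% size s)) i.
    rewrite cyclic_rootS; left; apply/run_VV; exists 0%N => //.
    exact: cyclic_root_mem.
  have [h|h] := root_exit ni; first by left; apply/run_VV; exists 1%N.
  by right; apply: subset_trans h _; exact: run_hull_mono.
have [h|h] := run_descend i (ltn0Sn j) jk Vj; last by right.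
by left; apply/run_VV; exists j.+2.
Qed.

Lemma run_hull_images :
  convex_hull (\bigcup_(i in [set: 'I_m]) mx_image (B i) G) = G.
Proof.
apply/seteqP; split.
  apply: convex_hull_min; first exact: convex_hull_convex.
  by move=> _ [i _ [u Gu <-]]; exact: run_stable.
apply: hull_of_seq_min; first exact: convex_hull_convex.
suff : forall V, V \in VV k ->
    exists i, exists2 V', V' \in VV k & V = mx_image (B i) V'.
  move=> h V /h[i [V' V'k ->]] _ [u Vu <-]; apply: sub_convex_hull.
  by exists i => //; exists u => //; exact: (hull_of_seqP V'k).
move=> V /run_VV[[|j] jk Vj].
  have [q _ ->] := root_cyclic Vj.
  (* The cyclic predecessor of [q], written without subtraction so that [q = 0] needs no separate
     case. *)
  have -> : cyclic_root q = cyclic_root (q + (size s).-1).+1.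
    by rewrite /cyclic_root -addnS prednK // modnDr.
  rewrite -cyclic_rootS.
  exists (nth i0 s ((q + (size s).-1) %% size s)).
  exists (cyclic_root (q + (size s).-1)) => //.
  by apply/run_VV; exists 0%N => //; exact: cyclic_root_mem.
have [i [V' V'j ->]] := run_origin Vj; exists i, V' => //.
by apply/run_VV; exists j => //; exact: ltnW.
Qed.

Hypothesis bodyG : convex_body G.

Lemma gauge_word w u : gauge G (word_mx B w *m u) <= gauge G u.
Proof.
apply: gauge_image => // v; apply: word_mx_stable => i; exact: run_stable.
Qed.

(** Outside the root each letter either moves to a set one iteration later or enters the interior of
    [G]. As [HH k] is empty, the interior is entered within [k - j] letters, and the gauge then
    stays below 1. *)
Lemma late_sets_sink j V w p : (0 < j)%N -> (j <= k)%N -> V \in HH j ->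
  (k <= j + size w)%N -> V p -> gauge G (word_mx B w *m p) < 1.
Proof.
elim: w j V p => [|i w IH] j V p j0; rewrite leq_eqVlt => /predU1P[->|jk] Vj.
- by move: Vj; rewrite HHk.
- by rewrite addn0 leqNgt jk.
- by move: Vj; rewrite HHk.
rewrite word_mx_cons -mulmxA => kw Vp.
have BVp : mx_image (B i) V (B i *m p) by exists p.
have [h|h] := run_descend i j0 jk Vj.
  by apply: (IH _ _ _ _ jk h) => //; rewrite addSnnS.
by apply: le_lt_trans (gauge_word _ _) _; apply: gauge_interior => //; exact: h.
Qed.

(** A deviation from the candidate among the first [T] letters leaves at least [k] letters, enough
    for [late_sets_sink]. *)
Lemma surviving_word T q w p : (T + k <= size w)%N -> cyclic_root q p ->
  1 <= gauge G (word_mx B w *m p) ->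
  forall t, (t < T)%N -> nth i0 w t = nth i0 s ((q + t) %% size s).
Proof.
elim: T q w p => // T IH q [|i w] p; first by rewrite ltnNge leq0n.
rewrite addSn /= ltnS => sw Vp; rewrite word_mx_cons -mulmxA => surv.
have BVp : mx_image (B i) (cyclic_root q) (B i *m p) by exists p.
have [ei|/eqP ni] := eqVneq (nth i0 s (q %% size s)) i.
  rewrite -ei cyclic_rootS ei in BVp.
  case=> [|t] tT /=; first by rewrite addn0.
  by rewrite (IH _ _ _ sw BVp surv) // addSnnS.
exfalso; move: surv; rewrite leNgt => /negP; apply.
have [h|h] := root_exit ni.
  apply: (late_sets_sink _ _ h) => //.
  by apply: leq_trans (leq_addl 1 _); apply: leq_trans sw; exact: leq_addl.
apply: le_lt_trans (gauge_word _ _) _; apply: gauge_interior => //.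
exact: (run_hull_mono k_gt0 (h _ BVp)).
Qed.

(** A root point that survives forces the first [size s] letters of [w]; by primitivity all
    surviving root points lie in one root set. The remaining [k] letters sink all the other points
    of the final sets. *)
Lemma surviving_points w u : primitive_word s -> size w = (size s + k)%N ->
  G u -> 1 <= gauge G (word_mx B w *m u) ->
  exists q, convex_hull (cyclic_root q) u.
Proof.
move=> prim sw Gu surv.
have [[q [p [qs Vp survp]]]|nex] := pselect (exists q, exists p,
    [/\ (q < size s)%N, cyclic_root q p & 1 <= gauge G (word_mx B w *m p)]).
  exists q.
  have : G `<=` [set v | gauge G (word_mx B w *m v) < 1] `|`
      convex_hull (cyclic_root q).
    (* The right-hand side is convex: W v has gauge < 1 at an interior point v of a
       segment as soon as it does at one of its ends. *)
    apply: hull_of_seq_min.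
      apply/convexP => v v' t vS v'S t0 t1.
      have le1 v0 : ([set v | gauge G (word_mx B w *m v) < 1] `|`
          convex_hull (cyclic_root q)) v0 -> gauge G (word_mx B w *m v0) <= 1.
        move=> [/ltW //|hv]; apply: le_trans (gauge_word _ _) _.
        apply/gauge_le1 => //; apply: convex_hull_min hv.
          exact: convex_hull_convex.
        apply: hull_of_seqP; apply/run_VV; exists 0%N => //.
        exact: cyclic_root_mem.
      have comb : gauge G (word_mx B w *m (t *: v + (1 - t) *: v')) <=
          t * gauge G (word_mx B w *m v) + (1 - t) * gauge G (word_mx B w *m v').
        rewrite mulmxDr -!scalemxAr; apply: le_trans (gaugeD bodyG _ _) _.
        by rewrite !(gaugeZ bodyG) ?subr_ge0.
      have [t00|tn0] := eqVneq t 0.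
        by rewrite t00 scale0r add0r subr0 scale1r.
      have [t11|tn1] := eqVneq t 1.
        by rewrite t11 subrr scale0r addr0 scale1r.
      have tp : 0 < t by rewrite lt_neqAle eq_sym tn0.
      have tp1 : 0 < 1 - t by rewrite subr_gt0 lt_neqAle tn1.
      have lev := le1 _ vS; have lev' := le1 _ v'S.
      case: vS => [lv|hv].
        left; apply: le_lt_trans comb _.
        have : t * gauge G (word_mx B w *m v) < t * 1 by rewrite ltr_pM2l.
        have := ler_wpM2l (ltW tp1) lev'; lra.
      case: v'S => [lv'|hv'].
        left; apply: le_lt_trans comb _.
        have : (1 - t) * gauge G (word_mx B w *m v') < (1 - t) * 1.
          by rewrite ltr_pM2l.
        have := ler_wpM2l (ltW tp) lev; lra.
      right; have /convexP := @convex_hull_convex R d (cyclic_root q).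
      exact.
    move=> V /run_VV_lt[[|j] jk Vj] v Vv; last first.
      left; apply: (late_sets_sink _ _ Vj) => //; first exact: ltnW.
      by rewrite sw; lia.
    have [q' q's e] := root_cyclic Vj; rewrite e in Vv.
    have [lt1|ge1] := ltP (gauge G (word_mx B w *m v)) 1; first by left.
    right; suff -> : q = q' by exact: sub_convex_hull.
    apply: (@primitive_rot_inj _ i0 s) => // t ts.
    rewrite -(@surviving_word (size s) q w p) ?sw //.
    by rewrite -(@surviving_word (size s) q' w v) ?sw.
  by move=> /(_ u Gu)[|//]; rewrite /= ltNge surv.
(* If no root point survives, [w] sinks every final set, hence all of [G], including [u]. *)
exfalso; move: surv; rewrite leNgt => /negP; apply.
move: u Gu; apply: (@hull_of_seq_min _ _ _ [set u | _]).
  exact: convex_gauge_lt.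
move=> V /run_VV_lt[[|j] jk Vj] v Vv /=; last first.
  apply: (late_sets_sink _ _ Vj) => //; first exact: ltnW.
  by rewrite sw; lia.
have [q qs e] := root_cyclic Vj; rewrite e in Vv.
by rewrite ltNge; apply/negP => ge1; apply: nex; exists q, v.
Qed.

End Runs.

(** Here [M] is the maximum of [gauge G] on [G'] itself, and the aim is [kappa * M <= 1]. Some
    product of length [n] reaches [M] from a point [g] of [G'], so [g / M] survives in [G] and
    [kappa <= gauge G' (g / M) <= 1 / M]. *)
Lemma sub_body_of_words {R : realType} {d m : nat} (B : 'I_m -> 'M[R]_d)
    (G G' : set 'cV[R]_d) (kappa : R) (n : nat) :
  convex_body G -> convex_body G' -> 0 < kappa ->
  G' `<=` convex_hull (\bigcup_(i in [set: 'I_m]) mx_image (B i) G') ->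
  (forall w u, size w = n -> G u -> 1 <= gauge G (word_mx B w *m u) ->
     kappa <= gauge G' u) ->
  forall u, gauge G' u <= kappa -> G u.
Proof.
move=> bG bG' k0 hG' words u uk.
have [_ cG' _ _] := bG'.
have [q /set_mem G'q qmax] : exists2 q, q \in G' &
    forall g, g \in G' -> gauge G g <= gauge G q.
  apply: compact_EVT_max => //; first by exists 0; exact: body0.
  apply: continuous_subspaceT; exact: gauge_continuous.
set M := gauge G q in qmax.
have Mk : kappa * M <= 1.
  have [M0|Mn0] := eqVneq M 0; first by rewrite M0 mulr0.
  have Mp : 0 < M by rewrite lt_neqAle eq_sym Mn0 gauge_ge0.
  have [w [g [sw Gg Mg]]] : exists w, exists g,
      [/\ size w = n, G' g & M <= gauge G (word_mx B w *m g)].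
    apply: contrapT => nex.
    (* The identity matrix only gives the set the form required by [convex_gauge_lt]. *)
    have : G' `<=` [set v | gauge G (1%:M *m v) < M].
      apply: (hull_words hG' (n := n)); first exact: convex_gauge_lt.
      move=> w g sw Gg /=; rewrite mul1mx ltNge; apply/negP => ge.
      by apply: nex; exists w, g.
    by move=> /(_ q G'q) /=; rewrite mul1mx ltxx.
  have MV0 : 0 <= M^-1 by rewrite invr_ge0 ltW.
  have : kappa <= gauge G' (M^-1 *: g).
    apply: (words w) => //.
      apply/gauge_le1 => //; rewrite gaugeZ // mulrC ler_pdivrMr // mul1r.
      by apply: qmax; rewrite inE.
    by rewrite -scalemxAr gaugeZ // mulrC ler_pdivlMr // mul1r.
  rewrite gaugeZ // mulrC ler_pdivlMr // => /le_trans; apply.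
  exact/gauge_le1.
apply/gauge_le1 => //; apply: le_trans Mk.
rewrite mulrC -ler_pdivrMr // mulrC -gaugeZ ?invr_ge0 ?(ltW k0) //.
apply: qmax; rewrite inE; apply/gauge_le1 => //.
by rewrite gaugeZ ?invr_ge0 ?(ltW k0) // mulrC ler_pdivrMr // mul1r.
Qed.

(** * Rescaling of families and sets *)

Section Scaling.
Context {R : realType} {d m : nat}.

Lemma hull_images_scaled (B : 'I_m -> 'M[R]_d) (c : R) (G : set 'cV[R]_d) :
  convex_hull (\bigcup_(i in [set: 'I_m]) mx_image (c *: B i) G) =
  dilate c (convex_hull (\bigcup_(i in [set: 'I_m]) mx_image (B i) G)).
Proof.
rewrite dilateE -convex_hull_image; congr convex_hull.
apply/seteqP; split=> [_ [i _ [u Gu <-]]|_ [_ [i _ [u Gu <-]] <-]].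
  exists (B i *m u); first by exists i => //; exists u.
  by rewrite mul_scalar_mx scalemxAl.
by exists i => //; exists u => //; rewrite mul_scalar_mx scalemxAl.
Qed.

Lemma dilate_inj (c : R) : c != 0 -> injective (@dilate R d c).
Proof.
move=> c0 X Y XY; apply/seteqP; split=> u.
  move=> Xu; have : dilate c Y (c *: u) by rewrite -XY; exists u.
  by move=> /(dilateP _ _ c0); rewrite scalerA mulVf // scale1r.
move=> Yu; have : dilate c X (c *: u) by rewrite XY; exists u.
by move=> /(dilateP _ _ c0); rewrite scalerA mulVf // scale1r.
Qed.

End Scaling.

Lemma first_set_nonzero {R : realType} {d : nat} (z : R[i]) (x y : 'cV[R]_d) :
  complex_vec x y != 0 -> (complex.Im z = 0 -> y = 0) ->
  exists2 e, first_set z x y e & e != 0.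
Proof.
move=> v0 y0; rewrite /first_set.
have xy0 : x = 0 -> y = 0 -> False.
  move=> x0 y0'; move: v0; rewrite x0 y0' => /eqP; apply.
  by apply/matrixP => i j; rewrite !mxE.
have [/y0 {}y0|_] := eqVneq (complex.Im z) 0.
  by exists x; [left | apply/eqP => /xy0; exact].
have [x0|xn0] := eqVneq x 0; last first.
  exists x => //; exists (1, 0) => /=; first by rewrite expr1n expr0n addr0.
  by rewrite scale1r scale0r addr0.
exists y; last by apply/eqP => /(xy0 x0).
exists (0, 1) => /=; first by rewrite expr1n expr0n add0r.
by rewrite scale1r scale0r add0r.
Qed.

(** * The body obtained on termination, and its uniqueness *)

Section Termination.
Context {R : realType} {d m : nat}.
Variables (A : 'I_m -> 'M[R]_d) (s : seq 'I_m) (z : R[i]) (x y : 'cV[R]_d).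
Variables (VV HH : nat -> seq (set 'cV[R]_d)) (k : nat).
Hypotheses (irrA : irreducible_family A) (candPi : candidate A s)
  (eigen : starting_eigenvector (word_mx (normalized A s) s) z x y)
  (run : algorithm_run (normalized A s) s (first_set z x y) VV HH)
  (halt : halts_after VV k).

Let B := normalized A s.
Let nu := averaged_radius A s.
Let V1 := first_set z x y.
Let G := hull_of_seq (VV k).

Lemma candidate_size_gt0 : (0 < size s)%N.
Proof. by have [/eqP s0 _ _] := candPi; rewrite lt0n size_eq0. Qed.

Lemma averaged_radius_gt0 : 0 < nu. Proof. by have [] := candPi. Qed.

Lemma normalizedE : A = (fun i => nu *: B i).
Proof.
apply/funext => i; rewrite /B /normalized scalerA divff ?scale1r //.
by rewrite gt_eqF // averaged_radius_gt0.
Qed.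

Lemma word_normalized w : word_mx A w = nu ^+ size w *: word_mx B w.
Proof. by rewrite {1}normalizedE word_mx_scale. Qed.

(** Normalization divides the candidate product by [nu ^+ size s], which is its spectral radius. *)
Lemma normc_leading : Normc.normc z = 1.
Proof.
have [[_ _ ->] _] := eigen.
have [s0 _ _] := candPi.
have nus : 0 < nu ^+ size s by rewrite exprn_gt0 ?averaged_radius_gt0.
have -> : word_mx (normalized A s) s = (nu ^+ size s)^-1 *: word_mx A s.
  by rewrite word_normalized scalerA mulVf ?scale1r // gt_eqF.
rewrite spectral_radius_scale ?invr_gt0 // -averaged_radius_exp // mulVf //.
by rewrite gt_eqF.
Qed.

Lemma starting_set_invariant : mx_image (word_mx B s) V1 = V1.
Proof.
by have [[_ Mv _] y0] := eigen; exact: first_set_invariant Mv normc_leading y0.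
Qed.

Lemma halt_gt0 : (0 < k)%N. Proof. by case: halt. Qed.

Lemma halt_HH : HH k = [::].
Proof.
have [k0 e _] := halt; have := halt_iff_no_new_set k.-1 run.
by rewrite prednK // => -[/(_ e)].
Qed.

(** Serves only as the default letter for [nth]. *)
Definition first_letter : 'I_m.
Proof. by case: s candidate_size_gt0 => // i. Defined.

Lemma halt_stable i u : G u -> G (B i *m u).
Proof.
exact: (run_stable run first_letter candidate_size_gt0 starting_set_invariant
  halt_HH).
Qed.

Lemma halt_images :
  convex_hull (\bigcup_(i in [set: 'I_m]) mx_image (B i) G) = G.
Proof.
exact: (run_hull_images run first_letter candidate_size_gt0
  starting_set_invariant halt_HH).
Qed.

Lemma starting_set_kept : V1 \in VV k.
Proof.
apply/(run_VV run); exists 0%N => //.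
have := cyclic_root_mem run candidate_size_gt0 0.
rewrite /cyclic_root mod0n take0 (_ : mx_image _ _ = V1) //.
apply/seteqP; split=> [_ [u Vu <-]|u Vu]; first by rewrite mul1mx.
by exists u => //; rewrite mul1mx.
Qed.

(** All final sets are linear images of the starting set, which passes on symmetry and compactness
    of its hull; interior points come from irreducibility and a nonzero starting point. *)
Lemma halt_body : convex_body G.
Proof.
have words V : V \in VV k -> exists w, V = mx_image (word_mx B w) V1.
  by move=> /(run_VV run)[j _ /(run_word run)].
have GN u : G u -> G (- u).
  apply: convex_hull_opp => {}u; elim: (VV k) words => [|V Vs IH] words.
    by rewrite big_nil.
  rewrite big_cons => -[Vu|Vu]; last first.
    by right; apply: IH Vu => W WVs; apply: words; rewrite in_cons WVs orbT.
  left; have [|w e] := words V; first by rewrite mem_head.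
  move: Vu; rewrite e => -[p Vp <-].
  by exists (- p); [exact: first_setN | rewrite mulmxN].
have cG : @convex_set R 'cV[R]_d G by exact: convex_hull_convex.
split=> //.
  apply: compact_hull_of_seq => V /words[w ->]; rewrite convex_hull_image.
  apply: compact_mx_image; exact: compact_hull_first_set.
have [[v0 _ _] y0] := eigen; have [e V1e e0] := first_set_nonzero v0 y0.
apply: (irreducible_interior irrA _ cG GN halt_stable _ e0).
  by move=> i; rewrite {1}normalizedE.
exact: (hull_of_seqP starting_set_kept).
Qed.

Lemma dim_gt0 : (0 < d)%N.
Proof.
have [[v0 _ _] _] := eigen; rewrite lt0n; apply: contraNneq v0 => d0.
by apply/eqP/matrixP => -[i id]; exfalso; rewrite d0 in id.
Qed.

Lemma jsr_halt : joint_spectral_radius A = nu.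
Proof.
rewrite normalizedE.
apply: (@joint_spectral_radius_scaled _ _ _ B G dim_gt0 halt_body halt_stable
  _ _ averaged_radius_gt0).
by rewrite halt_images.
Qed.

Lemma halt_invariant_body : invariant_body A G.
Proof.
split; first exact: halt_body.
by rewrite jsr_halt {1}normalizedE hull_images_scaled halt_images.
Qed.

Lemma halt_unique (lambda : R[i]) (G' : set 'cV[R]_d) :
  leading_eigenpair (word_mx A s) lambda (complex_vec x y) ->
  complex.Im lambda = 0 \/ irrational_mod_pi lambda ->
  invariant_body A G' ->
  exists2 c : R, 0 < c & G' = dilate c G.
Proof.
move=> [v0 eA _] arg [bG' hG'].
have nu0 := averaged_radius_gt0; have nus : 0 < nu ^+ size s by rewrite exprn_gt0.
have [[_ eB _] y0] := eigen.
have imB : convex_hull (\bigcup_(i in [set: 'I_m]) mx_image (B i) G') = G'.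
  apply: (@dilate_inj _ _ nu); first by rewrite gt_eqF.
  rewrite -hull_images_scaled -jsr_halt -hG'; congr convex_hull.
  by apply: eq_bigcupr => i _; rewrite jsr_halt [in RHS]normalizedE.
have stab i u : G' u -> G' (B i *m u).
  by move=> G'u; rewrite -imB; apply: sub_convex_hull; exists i => //; exists u.
have stabw w u : G' u -> G' (word_mx B w *m u).
  by apply: word_mx_stable.
(* Both eigenvalue equations hold for the same nonzero vector, so the eigenvalues differ by the
   positive normalizing factor and have the same argument. *)
have lz : lambda = real_complex R (nu ^+ size s) * z.
  apply/eqP; rewrite -subr_eq0; apply: contraTT v0 => n0; rewrite negbK.
  rewrite -(inj_eq (scalerI n0)) scaler0 scalerBl -scalerA -eA -eB.
  rewrite (_ : map_mx _ (word_mx A s) = real_complex R (nu ^+ size s) *: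
     map_mx (real_complex R) (word_mx (normalized A s) s)).
    by rewrite -scalemxAl subrr.
  by apply/matrixP => i j; rewrite word_normalized !mxE rmorphM.
have cst u v : V1 u -> V1 v -> gauge G' u = gauge G' v.
  rewrite /V1 /first_set; have [_|imz] := eqVneq (complex.Im z) 0.
    by move=> [->|->] [->|->]; rewrite ?gaugeN.
  case: arg => [im0|[phi lphi irr]].
    exfalso; move: im0 imz; rewrite lz; case: (z) => a b /=.
    by rewrite mul0r addr0 => /eqP; rewrite mulf_eq0 gt_eqF //= => ->.
  have nl : Normc.normc lambda = nu ^+ size s.
    rewrite lz Normc.normcM normc_leading mulr1 /= expr0n addr0 sqrtr_sqr.
    by rewrite gtr0_norm.
  have zphi : z = Complex (cos phi) (sin phi).
    move: lphi; rewrite nl lz; case: (z) => a b [].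
    rewrite !mul0r subr0 addr0 => /(mulfI (lt0r_neq0 nus)) ->.
    by move=> /(mulfI (lt0r_neq0 nus)) ->.
  have [] := complex_vec_eigen eB; rewrite zphi /= => Mx My.
  by apply: (gauge_ellipse_const bG' _ irr Mx My) => w; exact: stabw.
have [e V1e e0] := first_set_nonzero v0 y0.
pose kappa := gauge G' e.
have k0 : 0 < kappa.
  rewrite lt_neqAle gauge_ge0 // andbT eq_sym; apply: contraNneq e0.
  by move=> /(gauge_eq0 bG') ->.
have kV u : V1 u -> gauge G' u = kappa by move=> V1u; exact: cst.
have GG' : G `<=` [set u | gauge G' u <= kappa].
  apply: hull_of_seq_min; first exact: convex_gauge_le.
  move=> V /(run_VV run)[j _ /(run_word run)[w ->]] _ [p Vp <-] /=.
  by rewrite -(kV _ Vp); apply: gauge_image => // v; exact: stabw.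
have G'G u : gauge G' u <= kappa -> G u.
  apply: (sub_body_of_words (B := B) (n := size s + k)%N halt_body bG' k0).
    by rewrite imB.
  move=> w {}u sw Gu surv; have [_ prim _] := candPi.
  have [q] := surviving_points run first_letter candidate_size_gt0
    starting_set_invariant halt_HH halt_gt0 halt_body prim sw Gu surv.
  rewrite /cyclic_root convex_hull_image hull_first_set; set t := (_ %% _)%N.
  move=> [_ [r [p [r0 r1 Vp ->]]] eu].
  have Gp : gauge G (word_mx B w *m (word_mx B (take t s) *m p)) <= 1.
    apply/(gauge_le1 halt_body); apply: (word_mx_stable _ halt_stable).
    apply: (word_mx_stable _ halt_stable); exact: (hull_of_seqP starting_set_kept).
  (* [gauge G] of the image of [u] under [w] is at least 1 and at most [r], so [u] lies on the root
     set and not inside its hull. *)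
  have re1 : r = 1.
    apply/eqP; rewrite eq_le r1 /=; apply: le_trans surv _.
    rewrite -eu -!scalemxAr (gaugeZ halt_body) //.
    by rewrite ler_piMr.
  (* The rest of the candidate carries [u] back to the starting set, where [gauge G'] is [kappa]; as
     products do not increase it, [kappa <= gauge G' u]. *)
  have V1p : V1 (word_mx B s *m p) by rewrite -starting_set_invariant; exists p.
  rewrite -(kV _ V1p) -{1}(cat_take_drop t s) word_mx_cat -mulmxA -eu re1 scale1r.
  by apply: gauge_image => // v; exact: stabw.
(* The two inclusions say that [G] is the sublevel set [gauge G' <= kappa], that is, [kappa] times
   [G']. *)
exists kappa^-1; first by rewrite invr_gt0.
have kn0 : kappa^-1 != 0 by rewrite invr_eq0 gt_eqF.
apply/seteqP; split=> u.
  move=> G'u; apply/(dilateP _ _ kn0); rewrite invrK; apply: G'G.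
  rewrite (gaugeZ bG') ?(ltW k0) // ler_piMr ?(ltW k0) //.
  exact/(gauge_le1 bG').
move=> /(dilateP _ _ kn0); rewrite invrK => /GG' /=.
rewrite (gaugeZ bG') ?(ltW k0) // -ler_pdivlMl // mulVf ?gt_eqF //.
by move/(gauge_le1 bG').
Qed.

End Termination.

Theorem theorem3 (R : realType) (d m : nat) (A : 'I_m -> 'M[R]_d)
    (s : seq 'I_m) (z : R[i]) (x y : 'cV[R]_d)
    (VV HH : nat -> seq (set 'cV[R]_d)) (k : nat)
    (m_ge1 : (1 <= m)%N)
    (irrA : irreducible_family A)
    (candPi : candidate A s)
    (eigen : starting_eigenvector (word_mx (normalized A s) s) z x y)
    (run : algorithm_run (normalized A s) s (first_set z x y) VV HH)
    (halt : halts_after VV k) :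
  invariant_body A (hull_of_seq (VV k)) /\
  (forall lambda : R[i],
     leading_eigenpair (word_mx A s) lambda (complex_vec x y) ->
     complex.Im lambda = 0 \/ irrational_mod_pi lambda ->
     forall G : set 'cV[R]_d, invariant_body A G ->
       exists2 c : R, 0 < c & G = dilate c (hull_of_seq (VV k))).
Proof.
split; first exact: halt_invariant_body eigen run halt.
move=> lambda eA arg G' bG'.
exact: (halt_unique irrA candPi eigen run halt eA arg bG').
Qed.
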